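(* The following random particle configurations all give rise to path encodings such that $S\in\mathcal{S}_{sub-critical}$, $\mathbf{P}$-a.s., and are invariant in distribution under $T$ (that is, $T\eta\overset{d}{=}\eta$). (a) The particle configuration $(\eta_n)_{n\in\mathbb{Z}}$ given by a sequence of i.i.d. Bernoulli random variables with parameter $p\in[0,\frac{1}{2})$. (b) The particle configuration $(\eta_n)_{n\in\mathbb{Z}}$ given by a two-sided stationary Markov chain on $\{0,1\}$ with transition matrix \[\begin{pmatrix}1-p_0 & p_0\\ 1-p_1 & p_1\end{pmatrix}\] where $p_0\in (0,1)$, $p_1\in[0,1)$ satisfy $p_0+p_1<1$. (c) The particle configuration $(\eta_n)_{n\in\mathbb{Z}}$ given by conditioning a sequence of i.i.d. Bernoulli random variables with parameter $p\in(0,1)$ on the event $\sup_{n\in\mathbb{Z}}W_n\leq K$, for any $K\in\mathbb{Z}_+$, where this conditioning (on an event of probability $0$) is understood in the sense specified in the context.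
   Context: $\mathbb{Z}_+=\{0,1,2,\dots\}$. A particle configuration is $\eta=(\eta_n)_{n\in\mathbb{Z}}\in\{0,1\}^{\mathbb{Z}}$. Its path encoding is $S=(S_n)_{n\in\mathbb{Z}}$ with $S_0=0$, $S_n-S_{n-1}=1-2\eta_n$, an element of $\mathcal{S}^0=\{S:\mathbb{Z}\to\mathbb{Z} : S_0=0,\ |S_n-S_{n-1}|=1\ \forall n\}$. Let $M_n=\sup_{m\le n}S_m$. When $M_0<\infty$, $(TS)_n=2M_n-S_n-2M_0$, $T\eta$ is the configuration with path encoding $TS$, and the carrier process is $W=M-S$. Let $\mathcal{S}_{sub-critical}=\mathcal{S}_{sub-critical}^-\cap\mathcal{S}_{sub-critical}^+$, where $\mathcal{S}_{sub-critical}^{\pm}$ is the set of $S\in\mathcal{S}^0$ with $\lim_{n\to\pm\infty}S_n/F(n)=1$ for some strictly increasing $F:\mathbb{Z}\to\mathbb{R}$. Conditioned configuration in (c): let $P=(P(x,y))_{x,y\in\mathbb{Z}_+}$ be given by $P(x,x+1)=p$ for $x\ge0$, $P(x,x-1)=1-p$ for $x\ge1$, $P(0,0)=1-p$, and $P(x,y)=0$ otherwise. Let $P^{(K)}$ be the restriction of $P$ to $\{0,\dots,K\}$, $\lambda_K\in(0,1)$ its eigenvalue of largest magnitude (Perron–Frobenius), and $h_K$ the corresponding strictly positive right eigenvector (unique up to scaling), $P^{(K)}h_K=\lambda_Kh_K$. Let \[\tilde{P}^{(K)}(x,y)=\frac{P^{(K)}(x,y)h_K(y)}{\lambda_Kh_K(x)},\qquad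 x,y\in\{0,\dots,K\},\] a stochastic matrix, and let $\tilde W^{(K)}=(\tilde W^{(K)}_n)_{n\in\mathbb{Z}}$ be the two-sided stationary Markov chain with transition matrix $\tilde P^{(K)}$. The conditioned configuration is $\eta=\tilde\eta^{(K)}$ with $\tilde\eta^{(K)}_n=\mathbf{1}_{\{\tilde W^{(K)}_n=\tilde W^{(K)}_{n-1}+1\}}$. (It arises as the limit in distribution as $N\to\infty$ of the truncated i.i.d. Bernoulli($p$) configuration $(\eta_n\mathbf{1}_{\{-N<n\le N\}})_{n\in\mathbb{Z}}$ conditioned on its carrier process being bounded by $K$.) *)

(* Defs.v *)
From HB Require Import structures.
From mathcomp Require Import all_boot all_order all_algebra.
From mathcomp Require Import complex.
From mathcomp Require Import all_classical all_reals all_analysis.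

Set Implicit Arguments.
Unset Strict Implicit.
Unset Printing Implicit Defensive.

Import Order.TTheory GRing.Theory Num.Theory.
Import numFieldNormedType.Exports.

Local Open Scope classical_set_scope.
Local Open Scope ring_scope.

HB.instance Definition _ (n : nat) := isPointed.Build 'I_n.+1 ord0.

HB.instance Definition _ (n : nat) := @isMeasurable.Build
  default_measure_display 'I_n.+1 discrete_measurable discrete_measurable0
  discrete_measurableC discrete_measurableU.

(* [eta n = true] iff there is a particle at [n]. *)
Definition config := int -> bool.

Definition is_path (S : int -> int) : Prop :=
  S 0 = 0 /\ forall n, `|S n - S (n - 1)| = 1.

(* The unique S with S_0 = 0 and S_n - S_{n-1} = 1 - 2 eta_n; see
   [path_enc0] and [path_encB]. *)
Definition path_enc (eta : config) (n : int) : int :=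
  match n with
  | Posz k => \sum_(0 <= i < k) (1 - 2 * (eta i.+1%:Z)%:Z)
  | Negz k => - \sum_(0 <= i < k.+1) (1 - 2 * (eta (- i%:Z))%:Z)
  end.

Lemma path_enc0 eta : path_enc eta 0 = 0.
Proof. exact: big_geq. Qed.

Lemma path_encB eta n :
  path_enc eta n - path_enc eta (n - 1) = 1 - 2 * (eta n)%:Z.
Proof.
case: n => [[|k]|k].
- by rewrite path_enc0 sub0r opprK big_nat1 oppr0.
- have -> : k.+1%:Z - 1 = k by rewrite -addn1 PoszD addrK.
  by rewrite /path_enc big_nat_recr //= addrAC subrr add0r.
- have -> : Negz k - 1 = Negz k.+1 by rewrite !NegzE -opprD -PoszD addn1.
  by rewrite /path_enc [X in _ - - X]big_nat_recr //= opprK addKr NegzE.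
Qed.

Definition config_of (S : int -> int) : config := fun n => S n - S (n - 1) == -1.

(* M_n = sup_{m <= n} S_m, the supremum being taken in int.  The library's
   [supremum] returns its default argument when the set is not bounded above;
   this is immaterial for a path with M_0 < oo. *)
Definition past_max (S : int -> int) (n : int) : int :=
  supremum 0 [set S m | m in [set m | m <= n]].

Definition T_path (S : int -> int) : int -> int :=
  fun n => 2 * past_max S n - S n - 2 * past_max S 0.

Definition T_config (eta : config) : config := config_of (T_path (path_enc eta)).

Section subcritical.
Variable R : realType.

Definition subcritical_minus : set (int -> int) :=
  [set S | is_path S /\ exists F : int -> R, {homo F : m n / m < n} /\
    (fun n : nat => (S (- n%:Z))%:~R / F (- n%:Z)) @ \oo --> (1 : R)].

Definition subcritical_plus : set (int -> int) :=
  [set S | is_path S /\ exists F : int -> R, {homo F : m n / m < n} /\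
    (fun n : nat => (S n%:Z)%:~R / F n%:Z) @ \oo --> (1 : R)].

Definition subcritical : set (int -> int) :=
  subcritical_minus `&` subcritical_plus.

End subcritical.

(* The product sigma-algebra on T^Z. *)
Definition cylinders d (T : measurableType d) : set (set (int -> T)) :=
  \bigcup_n preimage_set_system setT (fun x : int -> T => x n) measurable.

Definition zseq d (T : measurableType d) := g_sigma_algebraType (@cylinders d T).

Section processes.
Context (R : realType) (d : measure_display) (Omega : measurableType d).
Variable P : probability Omega R.

Definition eq_in_law d' (T : measurableType d') (X Y : Omega -> T) : Prop :=
  [/\ measurable_fun setT X, measurable_fun setT Y &
      forall A, measurable A -> pushforward P X A = pushforward P Y A].

Definition mutually_independent d' (T : measurableType d')
    (X : int -> {RV P >-> T}) : Prop :=
  forall (s : seq int) (A : int -> set T), uniq s ->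
    (forall n, measurable (A n)) ->
    P [set w | forall n, n \in s -> A n (X n w)] =
      (\prod_(n <- s) P (X n @^-1` A n))%E.

Definition iid_bernoulli (p : R) (eta : int -> {RV P >-> bool}) : Prop :=
  mutually_independent eta /\
  forall n A, distribution P (eta n) A = bernoulli_prob p A.

Definition stationary d' (T : measurableType d') (X : int -> {RV P >-> T}) : Prop :=
  forall k : int, eq_in_law ((fun w n => X (n + k) w) : Omega -> zseq T)
                            ((fun w n => X n w) : Omega -> zseq T).

Definition window_event T (X : int -> Omega -> T) (n : int) (k : nat)
    (x : nat -> T) : set Omega :=
  [set w | forall i, (i <= k)%N -> X (n + i%:Z) w = x i].

(* Written multiplicatively, so that conditioning on null events is harmless:
   P(X_n = x_0, ..., X_{n+k} = x_k, X_{n+k+1} = x_{k+1})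
     = P(X_n = x_0, ..., X_{n+k} = x_k) Q(x_k, x_{k+1}). *)
Definition markov_chain d' (T : measurableType d') (Q : T -> T -> R)
    (X : int -> {RV P >-> T}) : Prop :=
  forall (n : int) (k : nat) (x : nat -> T),
    P (window_event X n k.+1 x) =
    (P (window_event X n k x) * (Q (x k) (x k.+1))%:E)%E.

Definition stationary_markov_chain d' (T : measurableType d') (Q : T -> T -> R)
    (X : int -> {RV P >-> T}) : Prop :=
  markov_chain Q X /\ stationary X.

(* Where M_0 is infinite, T is undefined in the mathematics and [T_config] takes
   junk values; the first clause makes this event null. *)
Definition subcritical_and_T_invariant (eta : Omega -> config) : Prop :=
  {ae P, forall w, subcritical R (path_enc (eta w))} /\
  eq_in_law (T_config \o eta : Omega -> zseq bool) (eta : Omega -> zseq bool).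

End processes.

Section transitions.
Variable R : realType.

Definition two_state (p0 p1 : R) (x y : bool) : R :=
  let q := if x then p1 else p0 in if y then q else 1 - q.

Definition carrier_matrix (p : R) (x y : nat) : R :=
  if y == x.+1 then p
  else if x == y.+1 then 1 - p
  else if (x == 0%N) && (y == 0%N) then 1 - p
  else 0.

Definition carrier_matrix_trunc (p : R) (K : nat) : 'M[R]_K.+1 :=
  \matrix_(x, y) carrier_matrix p x y.

(* [lambda] is the eigenvalue of largest modulus among all complex eigenvalues
   of A, and [h] a strictly positive right eigenvector for it.  ([eigenvalue]
   refers to row vectors, but the spectrum is the same for columns.) *)
Definition perron_pair n (A : 'M[R]_n) (lambda : R) (h : 'cV[R]_n) : Prop :=
  [/\ forall mu : R[i], eigenvalue (map_mx (real_complex R) A) mu ->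
        `|mu| <= (lambda%:C)%C,
      A *m h = lambda *: h &
      forall x, 0 < h x 0].

Definition doob_transform n (A : 'M[R]_n) (lambda : R) (h : 'cV[R]_n)
    (x y : 'I_n) : R :=
  A x y * h y 0 / (lambda * h x 0).

End transitions.

Definition up_steps (Omega : Type) (K : nat) (W : int -> Omega -> 'I_K.+1)
    (w : Omega) : config :=
  fun n => W n w == (W (n - 1) w).+1 :> nat.

(* Main.v *)
(* Write [W] for the carrier, [W n = M n - S n]. A particle at [n] is an up-step of [W], an empty
   site is a down-step or, at level [0], a flat step, and [T eta] marks the down-steps of [W].
   Hence, if both [W] and [eta] are invariant in law under time reversal, [T eta] is distributed
   as the reversal of [eta], i.e. as [eta]. Time reversal of [W] follows from stationarity: the
   flow of mass through a level is the same in both directions, and for a process with steps of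
   size at most one this is detailed balance.

   In (a) and (b), [eta] is a two-state chain, always reversible. An exponential moment bound gives
   linear growth of [S] and an exponential tail for [W], so that [W] exists and is [o(S)]. In (c),
   [W] is reversible and recurrent; the law of [eta] is a product of transfer matrices, and an
   antitriangular intertwiner shows that it does not change when the word is read backwards.

   Sub-criticality needs only [W = o(S)]: [S + W] is nondecreasing, so a bounded strictly
   increasing perturbation of it can serve as [F]. *)
Require Import Defs.
From HB Require Import structures.
From mathcomp Require Import all_boot all_order all_algebra.
From mathcomp Require Import complex.
From mathcomp Require Import all_classical all_reals all_analysis.
From mathcomp Require Import zify ring lra.

Set Implicit Arguments.
Unset Strict Implicit.
Unset Printing Implicit Defensive.

Import Order.TTheory GRing.Theory Num.Theory.
Import numFieldNormedType.Exports.

Local Open Scope classical_set_scope.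
Local Open Scope ring_scope.

(** Reversing the carrier exchanges up-steps and down-steps, so it only relates [T eta] to [eta]
    read backwards; that [eta] itself is reversible is a separate fact, and the two facts meet
    opposite difficulties. In (a) and (b) [eta] is the Markov chain and the carrier a function of
    its whole past; the carrier becomes tractable once its last step, which shows the value of
    [eta], is kept along with it. In (c) the carrier is the Markov chain and [eta] a function of two
    consecutive states, in general not Markov, so detailed balance says nothing about its words and
    their symmetry is sought in the matrices. Laws are compared on finite windows only, where
    probabilities are explicit products. The running maximum moves at flat steps only. Where the
    carrier is bounded, as in (c), infinitely many flat steps on either side therefore give
    sub-criticality; in (a) and (b) it takes quantitative bounds, on the growth of [S] and on the
    depth of [S] below its maximum. *)

(* Measurability with respect to the discrete sigma-algebra on the codomain, which, unlike
   [measurable_fun], makes sense for codomains such as [int] that carry no canonical one. *)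
Definition dmeas d (Omega : measurableType d) (T : Type) (f : Omega -> T) :=
  forall B : set T, measurable (f @^-1` B).

(** * Measurability of countably valued maps *)

Section discrete_measurability.
Context d (Omega : measurableType d).
Implicit Types Q : Omega -> Prop.

Lemma measurable_existsC (I : countType) (Q : I -> Omega -> Prop) :
  (forall i, measurable [set w | Q i w]) -> measurable [set w | exists i, Q i w].
Proof.
move=> mQ; rewrite (_ : [set _ | _] = \bigcup_(i in setT) [set w | Q i w]).
  by rewrite bigcup_mkcond; apply: countable_bigcupT_measurable => // i; case: ifP.
by apply/seteqP; split=> [w [i Qi] | w [i _ Qi]]; exists i.
Qed.

Lemma measurable_forallC (I : countType) (Q : I -> Omega -> Prop) :
  (forall i, measurable [set w | Q i w]) -> measurable [set w | forall i, Q i w].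
Proof.
move=> mQ.
rewrite (_ : [set _ | _] = ~` [set w | exists i, (~` [set w' | Q i w']) w]).
  by apply: measurableC; apply: measurable_existsC => i; apply: measurableC.
apply/seteqP; split=> [w Qw [j] | w nQ j]; first exact.
by apply: contrapT => nQi; apply: nQ; exists j.
Qed.

Lemma measurable_imply (Q : Prop) Q' :
  (Q -> measurable [set w | Q' w]) -> measurable [set w | Q -> Q' w].
Proof.
move=> mQ; have [q|nq] := pselect Q.
  by rewrite (_ : [set _ | _] = [set w | Q' w]); [exact: mQ|apply/seteqP; split=> w /=; auto].
by rewrite (_ : [set _ | _] = setT) //; apply/seteqP; split=> w // _ /nq.
Qed.

Lemma dmeas_cst (T : Type) (x : T) : dmeas (fun _ : Omega => x).
Proof.
move=> B; have [Bx|nBx] := pselect (B x).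
  by rewrite (_ : _ @^-1` _ = setT) //; apply/seteqP; split.
by rewrite (_ : _ @^-1` _ = set0) //; apply/seteqP; split.
Qed.

Lemma dmeas_comp (T T' : Type) (g : T -> T') (f : Omega -> T) :
  dmeas f -> dmeas (g \o f).
Proof. by move=> mf B; exact: (mf (g @^-1` B)). Qed.

Lemma dmeas_pair (T T' : countType) (f : Omega -> T) (g : Omega -> T') :
  dmeas f -> dmeas g -> dmeas (fun w => (f w, g w)).
Proof.
move=> mf mg B.
rewrite (_ : _ @^-1` B = [set w | exists x : T * T',
    ([set _ | B x] `&` (f @^-1` [set x.1] `&` g @^-1` [set x.2])) w]).
  apply: measurable_existsC => x; apply: measurableI; last exact: measurableI.
  exact: (@dmeas_cst _ x B).
apply/seteqP; split=> [w Bw | w [[x y] [Bxy [/= fx gx]]]].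
  by exists (f w, g w); split.
by rewrite /= fx gx.
Qed.

Lemma dmeas2 (T T' : countType) U (h : T -> T' -> U) (f : Omega -> T) (g : Omega -> T') :
  dmeas f -> dmeas g -> dmeas (fun w => h (f w) (g w)).
Proof. by move=> mf mg; exact: (dmeas_comp (fun x => h x.1 x.2) (dmeas_pair mf mg)). Qed.

Lemma dmeas_eq (T : countType) (f : Omega -> T) :
  (forall z, measurable [set w | f w = z]) -> dmeas f.
Proof.
move=> mf B.
rewrite (_ : _ @^-1` B = [set w | exists z, B z /\ f w = z]).
  apply: measurable_existsC => z.
  by apply: measurableI; [exact: (dmeas_cst z)|exact: mf].
apply/seteqP; split=> [w Bw|w [z [Bz /= fz]]]; first by exists (f w).
by rewrite /= fz.
Qed.

Lemma dmeas_measurable_fun d' (T : measurableType d') (f : Omega -> T) :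
  dmeas f -> measurable_fun setT f.
Proof. by move=> mf _ B mB; rewrite setTI. Qed.

End discrete_measurability.

Definition discrete d (T : measurableType d) : Prop :=
  countable [set: T] /\ forall A : set T, measurable A.

Lemma discrete_dmeas d d' (Omega : measurableType d) (T : measurableType d')
  (f : Omega -> T) : discrete T -> measurable_fun setT f -> dmeas f.
Proof. by move=> [_ mT] mf B; rewrite -[X in measurable X]setTI; exact: mf. Qed.

Lemma discrete_bool : discrete bool.
Proof. by split=> //; exact: countableP. Qed.
Lemma discrete_nat : discrete nat.
Proof. by split=> //; exact: countableP. Qed.
Lemma discrete_ord n : discrete 'I_n.+1.
Proof. by split=> //; exact: countableP. Qed.

Lemma discrete_prod d d' (T : measurableType d) (T' : measurableType d') :
  discrete T -> discrete T' -> discrete (T * T')%type.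
Proof.
move=> [cT mT] [cT' mT']; split; first by rewrite -setXTT; exact: countableX.
move=> A; apply: countable_measurable.
  by move=> [x y]; rewrite (_ : [set _] = [set x] `*` [set y]);
    [exact: measurableX|apply/seteqP; split=> [_ ->|[x' y'] [/= -> ->]]].
apply: sub_countable (countableX cT cT').
by rewrite setXTT; exact: subset_card_le.
Qed.

(** * Measures on two-sided sequences *)

Section discrete_sequences.
Context d (T : measurableType d).

Definition coord (n : int) (z : zseq T) : T := z n.

Lemma measurable_coord n : measurable_fun setT (coord n).
Proof.
move=> _ B mB; rewrite setTI; apply: sub_sigma_algebra.
by exists n => //; exists B => //; rewrite setTI.
Qed.

Lemma measurable_zseq d' (Omega : measurableType d') (f : Omega -> zseq T) :
  (forall n, measurable_fun setT (fun w => f w n)) -> measurable_fun setT f.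
Proof.
move=> mf; apply: (@measurability _ _ Omega (zseq T) setT f (@cylinders _ T)) => //.
by move=> _ [_ [n _ [B mB <-]] <-]; rewrite setTI; exact: mf.
Qed.

Lemma measurable_window d' (Omega : measurableType d') (X : int -> Omega -> T) n k x :
  discrete T -> (forall i, dmeas (X i)) -> measurable (window_event X n k x).
Proof.
move=> dT mX; apply: (measurable_forallC (I := nat)) => i.
by apply: measurable_imply => _; exact: (mX _ [set x i]).
Qed.

(** Of two windows with a common centre, the wider one is contained in the other or disjoint from
    it; with the empty and the full set they form a pi-system. The centre is free because
    [past_markov] needs windows around its time [N]. *)
Lemma zseq_measure_unique (R : realType) (c : int)
    (m1 m2 : {measure set (zseq T) -> \bar R}) :
  discrete T -> m1 setT = m2 setT -> (m1 setT < +oo)%E ->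
  (forall M x, m1 (window_event coord (c - M%:Z) M.*2 x) =
               m2 (window_event coord (c - M%:Z) M.*2 x)) ->
  forall A, measurable A -> m1 A = m2 A.
Proof.
move=> dT mTT mToo mwin A mA.
have mcoord i : dmeas (coord i) := discrete_dmeas dT (measurable_coord i).
pose G := [set A : set (zseq T) | A = setT \/ A = set0 \/
   exists M x, A = window_event coord (c - M%:Z) M.*2 x].
have Gm : G `<=` measurable.
  by move=> B [->|[->|[M [x ->]]]] //; exact: measurable_window.
apply: (@g_sigma_algebra_measure_unique _ _ _ G Gm (fun=> setT)) => //.
- by move=> _; left.
- by rewrite bigcup_const.
- suff win_sub M x N y : (M <= N)%N ->
      G (window_event coord (c - M%:Z) M.*2 x `&` window_event coord (c - N%:Z) N.*2 y).
    move=> B C [->|[->|[M [x ->]]]]; rewrite ?setTI ?set0I //; first by move=> _; right; left.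
    move=> [->|[->|[N [y ->]]]]; rewrite ?setIT ?setI0;
      [by right; right; exists M, x|by right; left|].
    by have [/win_sub|/ltnW/win_sub] := leqP M N; rewrite // setIC.
  move=> MN; have [sub|nsub] := pselect (forall i, (i <= M.*2)%N -> y (N - M + i)%N = x i).
    right; right; exists N, y; rewrite setIC; apply: setIidl => z zy i iM.
    rewrite -sub // -(zy (N - M + i)%N); last by lia.
    by congr (coord _ z); lia.
  right; left; rewrite -subset0 => z [zx zy]; apply: nsub => i iM.
  rewrite -(zx i) // -(zy (N - M + i)%N); last by lia.
  by congr (coord _ z); lia.
- by move=> B [->|[->|[M [x ->]]]] //; rewrite !measure0.
- apply: (smallest_sub (smallest_sigma_algebra _ G) _ mA).
  move=> _ [n _ [B mB <-]]; rewrite setTI.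
  have /countable_injP[e einj] := dT.1.
  pose M := absz (n - c)%R; pose j := absz (n - (c - M%:Z))%R.
  have nj : n = c - M%:Z + j%:Z by rewrite /j /M; lia.
  have jM : (j <= M.*2)%N by rewrite /j /M; lia.
  (* Patterns are coded by lists of naturals through the injection [e], which makes the union over
     patterns countable. *)
  pose pat (s : seq nat) (i : nat) : T := 'pinv_(fun=> point) setT e (nth 0%N s i).
  rewrite (_ : _ @^-1` B = [set z | exists s : seq nat, B (pat s j) /\
      window_event coord (c - M%:Z) M.*2 (pat s) z]).
    apply: (@measurable_existsC _ (g_sigma_algebraType G)) => s.
    apply: measurableI; first exact: (@dmeas_cst _ (g_sigma_algebraType G) _ (pat s j) B).
    by apply: sub_sigma_algebra; right; right; exists M, (pat s).
  apply/seteqP; split => [z /= Bz|z [s [Bs ws]]] /=.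
    pose s := [seq e (z (c - M%:Z + i%:Z)) | i <- iota 0 M.*2.+1].
    have pats i : (i <= M.*2)%N -> pat s i = z (c - M%:Z + i%:Z).
      move=> iM; rewrite /pat /s (nth_map 0%N) ?size_iota // nth_iota // add0n.
      by rewrite pinvKV ?inE.
    exists s; split; first by rewrite pats // -nj.
    by move=> i iM; rewrite pats.
  by have := ws j jM; rewrite /coord -nj => ->.
Qed.

End discrete_sequences.

Arguments coord {d T} n z.

(** * Real-valued probabilities *)

Section real_probability.
Context (R : realType) d (Omega : measurableType d) (P : probability Omega R).
Implicit Types A B : set Omega.

Definition prb A : R := fine (P A).

Lemma prbE A : measurable A -> P A = (prb A)%:E.
Proof. by move=> mA; rewrite fineK // fin_num_measure. Qed.

Lemma prb_ge0 A : 0 <= prb A.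
Proof. by rewrite fine_ge0. Qed.

Lemma prb0 : prb set0 = 0.
Proof. by rewrite /prb measure0. Qed.

Lemma prbT : prb setT = 1.
Proof. by rewrite /prb probability_setT. Qed.

Lemma le_prb A B : measurable A -> measurable B -> A `<=` B -> prb A <= prb B.
Proof. by move=> mA mB AB; rewrite -lee_fin -!prbE // le_measure ?inE. Qed.

Lemma prb_le1 A : measurable A -> prb A <= 1.
Proof. by move=> mA; rewrite -prbT; apply: le_prb. Qed.

Lemma prb_split A B : measurable A -> measurable B ->
  prb A = prb (A `&` B) + prb (A `&` ~` B).
Proof.
move=> mA mB; apply: EFin_inj; rewrite EFinD -!prbE //;
  do ?[exact: measurableI | by apply: measurableI => //; exact: measurableC].
by rewrite (measureDI P mA mB) addeC setDE.
Qed.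

Lemma prb_partition (I : finType) (Y : Omega -> I) A : measurable A -> dmeas Y ->
  prb A = \sum_i prb (A `&` Y @^-1` [set i]).
Proof.
move=> mA mY.
suff split (s : seq I) : uniq s ->
    prb A = \sum_(i <- s) prb (A `&` Y @^-1` [set i]) +
            prb (A `&` Y @^-1` [set i | i \notin s]).
  rewrite (split (index_enum I)) ?index_enum_uniq // (_ : _ `&` _ @^-1` _ = set0).
    by rewrite prb0 addr0.
  by apply/seteqP; split=> // w [_ /=]; rewrite mem_index_enum.
elim: s => [_|x s IH /= /andP[xs us]].
  by rewrite big_nil add0r; congr prb; apply/seteqP; split=> w // -[].
rewrite big_cons (IH us) -addrA [in RHS]addrCA; congr (_ + _).
rewrite [LHS](@prb_split _ (Y @^-1` [set x])) //; last exact: measurableI.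
congr (prb _ + prb _); apply/seteqP; split=> w /=.
- by case=> -[Aw _] Yx.
- by case=> Aw Yx; rewrite Yx.
- by case=> -[Aw Ys] Yx; split=> //; rewrite inE negb_or Ys andbT; apply/eqP.
- by case=> Aw; rewrite inE negb_or => /andP[/eqP].
Qed.

Lemma prb_ae A B : measurable A -> measurable B ->
  {ae P, forall w, A w <-> B w} -> prb A = prb B.
Proof.
move=> mA mB [N [mN N0 sub]]; congr fine.
have key C D : measurable C -> measurable D ->
    C `\` D `<=` N -> (P C <= P D)%E.
  move=> mC mD CDN; rewrite (measureDI P mC mD).
  rewrite [X in (X + _)%E](_ : _ = 0%E) ?add0e.
    by rewrite le_measure ?inE //; do ?[exact: subIsetr | exact: measurableI].
  by apply: (subset_measure0 _ mN) => //; exact: measurableD.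
apply/eqP; rewrite eq_le; apply/andP; split; apply: key => // w [Cw Dw];
  by apply: sub => -[? ?]; apply: Dw; auto.
Qed.

Lemma ae_prb0 A : measurable A -> prb A = 0 -> {ae P, forall w, ~ A w}.
Proof.
move=> mA A0; exists A; split=> //; first by rewrite prbE // A0.
by move=> w /= /contrapT.
Qed.

Lemma prb0_ae A : measurable A -> {ae P, forall w, ~ A w} -> prb A = 0.
Proof.
move=> mA nA; rewrite -prb0; apply: prb_ae => //.
by apply: filterS nA => w nA; split.
Qed.

Lemma ae_forallC (I : countType) (Q : I -> Omega -> Prop) :
  (forall i, {ae P, forall w, Q i w}) -> {ae P, forall w, forall i, Q i w}.
Proof.
move=> aeQ.
have /ae_foralln : forall n, {ae P, forall w, if unpickle n is Some i then Q i w else True}.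
  by move=> n; case: unpickle => [i|]; [exact: aeQ|exact: aeW].
by apply: filterS => w Qw i; have := Qw (pickle i); rewrite pickleK.
Qed.

(** Provides the two measures that [past_markov] compares: the law on the event of a transition, and
    the law on its starting state scaled by a transition probability. *)
Lemma sublaw_exists d' (T : measurableType d') (f : Omega -> T) (D : set Omega)
    (c : R) : measurable_fun setT f -> measurable D -> 0 <= c ->
  exists m : {measure set T -> \bar R},
    forall C : set T, m C = (c%:E * P (f @^-1` C `&` D))%E.
Proof.
move=> mf mD c0.
pose m0 : {measure set Omega -> \bar R} := mscale (NngNum c0) (mrestr P mD).
unshelve eexists (pushforward m0 f : {measure set T -> \bar R}); first exact: mf.
by [].
Qed.

End real_probability.

(** * Laws of discrete processes *)

Section laws_of_discrete_processes.
Context (R : realType) d (Omega : measurableType d) (P : probability Omega R).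
Context d' (T : measurableType d').
Implicit Types X Y : int -> Omega -> T.

Definition process X : Omega -> zseq T := fun w n => X n w.

Lemma measurable_process X : (forall n, dmeas (X n)) -> measurable_fun setT (process X).
Proof. by move=> mX; apply: measurable_zseq => n; exact: (dmeas_measurable_fun (mX n)). Qed.

Lemma eq_in_law_windows X Y : discrete T ->
  (forall n, dmeas (X n)) -> (forall n, dmeas (Y n)) ->
  (forall M x, prb P (window_event X (- M%:Z) M.*2 x) =
               prb P (window_event Y (- M%:Z) M.*2 x)) ->
  eq_in_law P (process X) (process Y).
Proof.
move=> dT mX mY XY; have mpX := measurable_process mX; have mpY := measurable_process mY.
split=> // A mA.
have [m1 m1E] := sublaw_exists P mpX measurableT ler01.
have [m2 m2E] := sublaw_exists P mpY measurableT ler01.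
have mE (Z : int -> Omega -> T) (m : {measure set (zseq T) -> \bar R}) :
    (forall C, m C = (1%:E * P (process Z @^-1` C `&` setT))%E) ->
    forall C, m C = P (process Z @^-1` C).
  by move=> mC C; rewrite mC mul1e setIT.
rewrite /pushforward -(mE _ _ m1E) -(mE _ _ m2E).
apply: (zseq_measure_unique (c := 0) dT) => //.
- by rewrite (mE _ _ m1E) (mE _ _ m2E) !preimage_setT.
- by rewrite (mE _ _ m1E) preimage_setT probability_setT ltry.
move=> M x; rewrite (mE _ _ m1E) (mE _ _ m2E) sub0r.
transitivity (P (window_event X (- M%:Z) M.*2 x)) => //.
rewrite prbE ?XY -?prbE //; exact: measurable_window.
Qed.

(* The Markov property on windows extends to every event of the past: both sides are measures
   of [A] under the process stopped at time [N], and they agree on windows centred at [N]. *)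
Lemma past_markov X (Q : T -> T -> R) : discrete T -> (forall n, dmeas (X n)) ->
  (forall x y, 0 <= Q x y) ->
  (forall n k x, prb P (window_event X n k.+1 x) =
                 prb P (window_event X n k x) * Q (x k) (x k.+1)) ->
  forall (N : int) (A : set (zseq T)), measurable A ->
  (forall z z' : zseq T, (forall i, i <= N -> z i = z' i) -> A z -> A z') ->
  forall x y,
  prb P [set w | A (process X w) /\ (X N w = x /\ X (N + 1) w = y)] =
  prb P [set w | A (process X w) /\ X N w = x] * Q x y.
Proof.
move=> dT mX Q0 XQ N A mA pastA x y.
pose clamp := process (fun i => X (Order.min i N)).
have mclamp : measurable_fun setT clamp by apply: measurable_process.
pose D1 := [set w | X N w = x /\ X (N + 1) w = y].
pose D2 := [set w | X N w = x].
have mD1 : measurable D1 by apply: measurableI; [exact: (mX _ [set x])|exact: (mX _ [set y])].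
have mD2 : measurable D2 by exact: (mX _ [set x]).
have [m1 m1E] := sublaw_exists P mclamp mD1 ler01.
have [m2 m2E] := sublaw_exists P mclamp mD2 (Q0 x y).
have clampA w : A (clamp w) <-> A (process X w).
  by split; apply: pastA => i iN; rewrite /clamp /process min_l.
have mcA : measurable (clamp @^-1` A) by rewrite -[X in measurable X]setTI; exact: mclamp.
have E1 : [set w | A (process X w) /\ (X N w = x /\ X (N + 1) w = y)] = clamp @^-1` A `&` D1.
  by apply/seteqP; split=> w [Aw Dw]; split=> //; apply/clampA.
have E2 : [set w | A (process X w) /\ X N w = x] = clamp @^-1` A `&` D2.
  by apply/seteqP; split=> w [Aw Dw]; split=> //; apply/clampA.
have mI1 : measurable (clamp @^-1` A `&` D1) by exact: measurableI.
have mI2 : measurable (clamp @^-1` A `&` D2) by exact: measurableI.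
rewrite E1 E2; apply: EFin_inj; rewrite mulrC EFinM -!prbE // -m2E.
rewrite -[LHS]mul1e -m1E.
have Qstep : (1%:E * P D1 = (Q x y)%:E * P D2)%E.
  pose xy i := if i is 0%N then x else y.
  have w1 : window_event X N 1 xy = D1.
    apply/seteqP; split=> [w ww|w [/= wx wy]].
      have := ww 0%N isT; rewrite addr0 => w0.
      by split; [exact: w0|exact: (ww 1%N)].
    by case=> [|[|//]] _; rewrite ?addr0.
  have w0 : window_event X N 0 xy = D2.
    apply/seteqP; split=> [w ww|w /= wx].
      by have := ww 0%N isT; rewrite addr0 => w0; exact: w0.
    by case=> // _; rewrite addr0.
  by rewrite mul1e !prbE // -w1 -w0 XQ -EFinM mulrC.
apply: (zseq_measure_unique (c := N) dT) => //.
- by rewrite m1E m2E !preimage_setT !setTI.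
- by rewrite m1E preimage_setT setTI prbE // mul1e ltry.
move=> M z; rewrite m1E m2E.
(* From index [M] on, the stopped process stays at [X N]; a pattern that differs from [x] there
   gives the empty event on both sides. *)
have [compat|ncompat] := pselect (forall i, (M <= i <= M.*2)%N -> z i = x); last first.
  have empty D : D `<=` D2 -> clamp @^-1` window_event coord (N - M%:Z) M.*2 z `&` D = set0.
    move=> DD2; rewrite -subset0 => w [zw /DD2 wx]; apply: ncompat => i /andP[Mi iM].
    rewrite -wx -(zw i) // /coord /clamp /process; congr (X _ w).
    by rewrite min_r //; lia.
  by rewrite !empty ?measure0 ?mule0 // => w [].
(* Dropping the constant tail of the pattern, and appending [y], leaves ordinary windows of [X]. *)
pose z' i := if (i <= M)%N then z i else y.
have w1 : clamp @^-1` window_event coord (N - M%:Z) M.*2 z `&` D1 =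
          window_event X (N - M%:Z) M.+1 z'.
  apply/seteqP; split=> [w [zw [wx wy]] i|w zw].
    rewrite leq_eqVlt => /predU1P[->|iM].
      by rewrite /z' ltnn -wy; congr (X _ w); lia.
    rewrite /z' -ltnS iM -(zw i); last by lia.
    by rewrite /coord /clamp /process min_l //; lia.
  have NM : N - M%:Z + M%:Z = N by rewrite subrK.
  have wN : X N w = x.
    by have := zw M (leqnSn _); rewrite NM /z' leqnn compat // leqnn -addnn leq_addr.
  split; last first.
    split=> //=; have := zw M.+1 (leqnn _); rewrite /z' ltnn => <-.
    by congr (X _ w); lia.
  move=> i iM; rewrite /coord /clamp /process; have [iM'|Mi] := leqP i M.
    rewrite min_l; last by lia.
    by rewrite zw ?(leqW iM') // /z' iM'.
  by rewrite min_r ?wN ?compat //; lia.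
have w2 : clamp @^-1` window_event coord (N - M%:Z) M.*2 z `&` D2 =
          window_event X (N - M%:Z) M z'.
  apply/seteqP; split=> [w [zw wx] i iM|w zw].
    rewrite /z' iM -(zw i); last by lia.
    by rewrite /coord /clamp /process min_l //; lia.
  have NM : N - M%:Z + M%:Z = N by rewrite subrK.
  have wN : X N w = x.
    by have := zw M (leqnn _); rewrite NM /z' leqnn compat // leqnn -addnn leq_addr.
  split=> // i iM; rewrite /coord /clamp /process; have [iM'|Mi] := leqP i M.
    rewrite min_l; last by lia.
    by rewrite zw // /z' iM'.
  by rewrite min_r ?wN ?compat //; lia.
rewrite w1 w2 mul1e !prbE; try exact: measurable_window.
rewrite XQ -EFinM mulrC; congr (_%:E); congr (Q _ _ * _).
  by rewrite /z' leqnn compat // leqnn -addnn leq_addr.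
by rewrite /z' ltnn.
Qed.

(** Balance carries [pi] through the product of transition weights, one factor at a time. The
    symmetry [s] is the identity for chains of states; for a chain of edges it exchanges end points,
    since reading a path backwards also turns each edge round. *)
Lemma reversible_windows X (Q : T -> T -> R) (pi : T -> R) (s : T -> T) :
  (forall n, dmeas (X n)) ->
  (forall n k x, prb P (window_event X n k.+1 x) =
                 prb P (window_event X n k x) * Q (x k) (x k.+1)) ->
  (forall n x, prb P [set w | X n w = x] = pi x) ->
  (forall x, pi (s x) = pi x) ->
  (forall x y, pi x * Q x y = pi (s y) * Q (s y) (s x)) ->
  forall n n' k x, prb P (window_event X n k x) =
    prb P (window_event X n' k (fun i => s (x (k - i)%N))).
Proof.
move=> mX XQ piE pis balance.
have closed n k x : prb P (window_event X n k x) =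
    pi (x 0%N) * \prod_(i < k) Q (x i) (x i.+1).
  elim: k => [|k IH]; last by rewrite XQ IH -mulrA big_ord_recr.
  rewrite big_ord0 mulr1 -(piE n); congr prb; apply/seteqP; split=> w /=.
    by move=> /(_ 0%N isT); rewrite addr0.
  by move=> wx [|//] _; rewrite addr0.
move=> n n' k x; rewrite !closed subn0.
have -> : \prod_(i < k) Q (s (x (k - i)%N)) (s (x (k - i.+1)%N)) =
          \prod_(i < k) Q (s (x i.+1)) (s (x i)).
  rewrite (reindex_inj rev_ord_inj) /=; apply: eq_bigr => i _.
  by congr (Q (s (x _)) (s (x _))); have := ltn_ord i; lia.
elim: k => [|k IH]; first by rewrite !big_ord0 !mulr1 pis.
by rewrite !big_ord_recr /= mulrA IH pis -mulrA mulrCA balance mulrCA.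
Qed.

(** The centre [a] is 0 for values at sites and 1 for steps: step [n] joins [n - 1] to [n], and the
    reflection of sites in 0 maps it to step [1 - n]. *)
Lemma reversible_law X (Q : T -> T -> R) (pi : T -> R) (s : T -> T) (a : int) :
  discrete T -> involutive s -> (forall n, dmeas (X n)) ->
  (forall n k x, prb P (window_event X n k.+1 x) =
                 prb P (window_event X n k x) * Q (x k) (x k.+1)) ->
  (forall n x, prb P [set w | X n w = x] = pi x) ->
  (forall x, pi (s x) = pi x) ->
  (forall x y, pi x * Q x y = pi (s y) * Q (s y) (s x)) ->
  eq_in_law P (process X) (process (fun n => s \o X (a - n))).
Proof.
move=> dT sK mX XQ piE pis balance; apply: eq_in_law_windows => //.
  by move=> n; exact: dmeas_comp.
move=> M x; rewrite (reversible_windows mX XQ piE pis balance _ (a - M%:Z)).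
congr prb; apply/seteqP; split=> w ww i iM /=.
  rewrite -[RHS](sK (x i)) (_ : a - _ = a - M%:Z + (M.*2 - i)%N%:Z); last by lia.
  by rewrite ww ?leq_subr // subKn.
have := ww (M.*2 - i)%N (leq_subr _ _) => /= <-; rewrite sK; congr (X _ w).
by lia.
Qed.

End laws_of_discrete_processes.

(** * The carrier and the transformation T *)

(** The predecessor is truncated: a hole met at level 0 is a flat step. The rule alone does not
    determine [V] (with no particles, [V] may come down from infinity); zeros arbitrarily far in the
    past do. *)
Definition carrier_rule (eta : config) (V : int -> nat) : Prop :=
  forall n, V n = if eta n then (V (n - 1)).+1 else (V (n - 1)).-1.

Lemma int_descent (Q : int -> Prop) (n : int) :
  Q n -> (forall m, m <= n -> Q m -> Q (m - 1)) -> forall m, m <= n -> Q m.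
Proof.
move=> Qn step m mn.
have -> : m = n - `|n - m|%N%:Z by lia.
elim: `|_|%N => [|k IH]; first by rewrite subr0.
rewrite (_ : n - _ = n - k%:Z - 1); last by lia.
by apply: step => //; lia.
Qed.

Lemma int_homo (f : int -> int) : (forall n, f (n - 1) <= f n) -> {homo f : m n / m <= n}.
Proof.
move=> fS m n; apply: (int_descent (Q := fun m => f m <= f n)) => // k _.
exact: le_trans.
Qed.

Lemma path_encS eta n :
  path_enc eta n = path_enc eta (n - 1) + (1 - 2 * (eta n)%:Z).
Proof. by rewrite -path_encB addrC subrK. Qed.

Lemma past_max_attained (S : int -> int) (m n : int) :
  m <= n -> (forall k, k <= n -> S k <= S m) -> past_max S n = S m.
Proof.
move=> mn Sm; rewrite /past_max /supremum.
have Am : [set S m | m in [set m | m <= n]] (S m) by exists m.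
case: ifPn => [/eqP A0|_]; first by rewrite A0 in Am.
apply: xget_subset1; last exact: is_subset1_supremums.
by split=> [_ [k kn <-]|x]; [exact: Sm|exact].
Qed.

(** A least upper bound of integers is attained, since otherwise one less would still be an upper
    bound. This fixes the default value on the null event, where measurability must hold too. *)
Lemma past_max_unbounded (S : int -> int) (n : int) :
  ~ (exists m, m <= n /\ forall k, k <= n -> S k <= S m) -> past_max S n = 0.
Proof.
move=> nomax; rewrite /past_max /supremum; case: ifPn => // _.
case: xgetP => // x _ [ubx lbx]; exfalso.
have [[k kn Sk]|nx] := pselect ([set S m | m in [set m | m <= n]] x).
  by apply: nomax; exists k; split=> // j jn; rewrite Sk; apply: ubx; exists j.
have /lbx : ubound [set S m | m in [set m | m <= n]] (x - 1).
  move=> _ [k kn <-].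
  have : S k <= x by apply: ubx; exists k.
  have : S k <> x by move=> Sk; apply: nx; exists k.
  by lia.
by rewrite lerDl.
Qed.

(** Up-steps and down-steps preserve the sum; a flat step raises it by one. *)
Lemma carrier_rule_homo eta V : carrier_rule eta V ->
  {homo (fun n => path_enc eta n + (V n)%:Z) : m n / m <= n}.
Proof.
move=> rule; apply: int_homo => n; rewrite (path_encS eta n) (rule n).
by case: (eta n); move: (path_enc _ _) (V _) => s v /=; lia.
Qed.

Lemma carrier_past_max eta V : carrier_rule eta V ->
  (forall n, exists m, m <= n /\ V m = 0%N) ->
  forall n, past_max (path_enc eta) n = path_enc eta n + (V n)%:Z.
Proof.
move=> rule zeros n.
have exk : exists k : nat, V (n - k%:Z) == 0%N.
  have [m [mn Vm]] := zeros n; exists `|n - m|%N; apply/eqP.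
  by rewrite -[RHS]Vm; congr V; lia.
case: (ex_minnP exk) => k /eqP Vk kmin.
(* No step is flat after the last zero of [V], so the sum is constant back to that zero, where it
   equals the path. *)
have flat j : (j <= k)%N -> path_enc eta (n - j%:Z) + (V (n - j%:Z))%:Z =
    path_enc eta n + (V n)%:Z.
  elim: j => [|j IH] jk; first by rewrite subr0.
  rewrite -(IH (ltnW jk)); have := rule (n - j%:Z); have := path_encS eta (n - j%:Z).
  have : V (n - j%:Z) <> 0%N by move=> /eqP /kmin; lia.
  rewrite (_ : n - j.+1%:Z = n - j%:Z - 1); last by lia.
  by case: (eta _) => /= Vn0 -> VE; rewrite VE in Vn0 *; lia.
rewrite -(flat k) // Vk addr0; apply: past_max_attained; first by lia.
move=> m mn; apply: (@le_trans _ _ (path_enc eta m + (V m)%:Z)); first by lia.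
rewrite (le_trans (carrier_rule_homo rule mn)) //.
by rewrite -(flat k) // Vk addr0.
Qed.

(** Up to a constant [T S] is [M + W]. Away from flat steps [M] is constant and [T S] moves with
    [W]; at a flat step [T S] goes up, so it goes down exactly when [W] does. *)
Lemma T_config_carrier eta V : carrier_rule eta V ->
  (forall n, exists m, m <= n /\ V m = 0%N) ->
  forall n, T_config eta n = (V n < V (n - 1)%R)%N.
Proof.
move=> rule zeros n; rewrite /T_config /config_of /T_path !(carrier_past_max rule zeros).
rewrite (path_encS eta n) (rule n).
move: (path_enc eta (n - 1)) (path_enc eta 0) (V 0) => s s0 v0.
by case: (eta n); case: (V (n - 1)) => [|v] /=; apply/idP/idP; lia.
Qed.

Section measurability_of_T.
Context d (Omega : measurableType d).

Lemma dmeas_path_enc (eta : int -> Omega -> bool) n : (forall n, dmeas (eta n)) ->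
  dmeas (fun w => path_enc (fun n => eta n w) n).
Proof.
move=> meta; case: n => k /=.
  elim: k => [|k IH].
    rewrite (_ : (fun _ => _) = fun=> 0); first exact: dmeas_cst.
    by apply/funext => w; rewrite big_geq.
  rewrite (_ : (fun _ => _) = fun w => \sum_(0 <= i < k) (1 - 2 * (eta i.+1%:Z w)%:Z)
      + (1 - 2 * (eta k.+1%:Z w)%:Z)); last by apply/funext => w; rewrite big_nat_recr.
  exact: (dmeas2 (fun s b => s + (1 - 2 * (nat_of_bool b)%:Z)) IH (meta _)).
apply: (dmeas_comp (fun s => - s)).
elim: k.+1 => [|k' IH].
  rewrite (_ : (fun _ => _) = fun=> 0); first exact: dmeas_cst.
  by apply/funext => w; rewrite big_geq.
rewrite (_ : (fun _ => _) = fun w => \sum_(0 <= i < k') (1 - 2 * (eta (- i%:Z) w)%:Z)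
    + (1 - 2 * (eta (- k'%:Z) w)%:Z)); last by apply/funext => w; rewrite big_nat_recr.
exact: (dmeas2 (fun s b => s + (1 - 2 * (nat_of_bool b)%:Z)) IH (meta _)).
Qed.

Lemma dmeas_past_max (S : int -> Omega -> int) n : (forall n, dmeas (S n)) ->
  dmeas (fun w => past_max (fun m => S m w) n).
Proof.
move=> mS; apply: dmeas_eq => z.
have mle m m' : measurable [set w | S m' w <= S m w].
  exact: (dmeas2 (fun x y : int => y <= x) (mS m) (mS m') [set b | b]).
pose ismax m w := m <= n /\ forall k, k <= n -> S k w <= S m w.
have mismax m : measurable [set w | ismax m w].
  apply: measurableI; first exact: (@dmeas_cst _ Omega _ m [set m | m <= n]).
  by apply: measurable_forallC => k; apply: measurable_imply => _.
(* Either the maximum is attained, with value [z], or there is none and [z] is the default 0. *)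
rewrite (_ : [set _ | _] = [set w | exists m, (ismax m `&` (S m @^-1` [set z])) w] `|`
    ([set _ | z = 0] `&` ~` [set w | exists m, ismax m w])).
  apply: measurableU.
    by apply: measurable_existsC => m; apply: measurableI; [exact: mismax|exact: (mS m [set z])].
  apply: measurableI; first exact: (@dmeas_cst _ Omega _ z [set z | z = 0]).
  by apply: measurableC; apply: measurable_existsC.
apply/seteqP; split=> [w /= wz|w [[m [[mn Sm] /= <-]]|[-> nomax]]] /=.
- have [[m [mn Sm]]|nomax] := pselect (exists m, ismax m w).
    by left; exists m; do !split=> //; rewrite -wz (past_max_attained mn Sm).
  by right; split=> //; rewrite -wz past_max_unbounded.
- exact: past_max_attained.
- exact: past_max_unbounded.
Qed.

Lemma dmeas_T_config (eta : int -> Omega -> bool) n : (forall n, dmeas (eta n)) ->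
  dmeas (fun w => T_config (fun n => eta n w) n).
Proof.
move=> meta.
have mS k := dmeas_path_enc k meta.
have mM k := dmeas_past_max k mS.
have mT k : dmeas (fun w => T_path (path_enc (fun n => eta n w)) k).
  apply: (dmeas2 (fun x y => x - 2 * y) _ (mM 0)).
  exact: (dmeas2 (fun x y => 2 * x - y) (mM k) (mS k)).
exact: (dmeas2 (fun x y => x - y == -1) (mT n) (mT (n - 1))).
Qed.

End measurability_of_T.

(** * Invariance from time reversal *)

Section T_invariance.
Context (R : realType) d (Omega : measurableType d) (P : probability Omega R).

Lemma eq_in_law_comp d1 d2 (T1 : measurableType d1) (T2 : measurableType d2)
  (X Y : Omega -> T1) (g : T1 -> T2) : measurable_fun setT g ->
  eq_in_law P X Y -> eq_in_law P (g \o X) (g \o Y).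
Proof.
move=> mg [mX mY XY]; split=> [||A mA]; [exact: measurableT_comp|exact: measurableT_comp|].
by apply: (XY (g @^-1` A)); rewrite -[X in measurable X]setTI; exact: mg.
Qed.

Lemma prb_law_ae d1 (T1 : measurableType d1) (X Y : Omega -> T1) A :
  measurable_fun setT X -> measurable_fun setT Y -> measurable A ->
  {ae P, forall w, X w = Y w} -> P (X @^-1` A) = P (Y @^-1` A).
Proof.
move=> mX mY mA XY.
have mpre (Z : Omega -> T1) : measurable_fun setT Z -> measurable (Z @^-1` A).
  by move=> mZ; rewrite -[X in measurable X]setTI; exact: (mZ measurableT _ mA).
rewrite !prbE; try exact: mpre.
congr _%:E; apply: prb_ae; try exact: mpre.
by apply: filterS XY => w XYw; rewrite /preimage /= XYw.
Qed.

(* [eta] marks the up-steps of the carrier and [T eta] its down-steps, so reversing the carrier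
   gives that [T eta] read backwards has the law of [eta]. *)
Lemma T_invariance (eta : int -> Omega -> bool) (V : int -> Omega -> nat) :
  (forall n, dmeas (eta n)) -> (forall n, dmeas (V n)) ->
  {ae P, forall w, carrier_rule (fun n => eta n w) (fun n => V n w)} ->
  {ae P, forall w, forall n, exists m, m <= n /\ V m w = 0%N} ->
  eq_in_law P (process V) (process (fun n => V (- n))) ->
  eq_in_law P (process eta) (process (fun n => eta (1 - n))) ->
  eq_in_law P (T_config \o process eta : Omega -> zseq bool) (process eta).
Proof.
move=> meta mV rule zeros revV reveta.
pose up (z : zseq nat) : zseq bool := fun n => (z (n - 1)%R < z n)%N.
pose flip (z : zseq bool) : zseq bool := fun n => z (1 - n).
pose tau : Omega -> zseq bool := fun w n => (V n w < V (n - 1)%R w)%N.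
have mcoordN n : dmeas (coord n : zseq nat -> nat).
  exact: (discrete_dmeas discrete_nat (measurable_coord n)).
have mup : measurable_fun setT up.
  apply: measurable_zseq => n; apply: dmeas_measurable_fun.
  exact: (dmeas2 (fun x y => (x < y)%N) (mcoordN (n - 1)) (mcoordN n)).
have mflip : measurable_fun setT flip by apply: measurable_zseq => n; exact: measurable_coord.
have mtau : measurable_fun setT tau.
  apply: measurable_zseq => n; apply: dmeas_measurable_fun.
  exact: (dmeas2 (fun x y => (x < y)%N) (mV n) (mV (n - 1))).
have mT : measurable_fun setT (T_config \o process eta : Omega -> zseq bool).
  apply: measurable_zseq => n; apply: dmeas_measurable_fun.
  exact: dmeas_T_config.
have mpeta := measurable_process meta.
split=> // A mA; rewrite /pushforward.
have Ttau : P ((T_config \o process eta) @^-1` A) = P (tau @^-1` A).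
  apply: prb_law_ae => //; move: rule zeros; apply: filterS2 => w rule zeros.
  by apply/funext => n /=; rewrite (T_config_carrier rule zeros).
have etaup B : measurable B -> P (process eta @^-1` B) = P ((up \o process V) @^-1` B).
  move=> mB; apply: prb_law_ae => //.
    by apply: measurableT_comp => //; exact: measurable_process.
  apply: filterS rule => w rule; apply/funext => n.
  by rewrite /process /up /= (rule n); case: (eta n w); rewrite ?ltnSn // ltnNge leq_pred.
have mflipA : measurable (flip @^-1` A) by rewrite -[X in measurable X]setTI; exact: mflip.
have [_ _ upV] := eq_in_law_comp mup revV.
have [_ _ eqeta] := reveta.
rewrite Ttau [RHS](eqeta A mA).
transitivity (P (process eta @^-1` (flip @^-1` A))) => //.
rewrite etaup // [RHS](upV _ mflipA) /pushforward.
(* Step [1 - n] of the reversed carrier goes from [V n] to [V (n - 1)]. *)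
congr (P _); apply/seteqP; suff E : flip \o (up \o process (fun n => V (- n))) = tau.
  by rewrite -E; split.
apply/funext => w; apply/funext => n; rewrite /flip /up /tau /process /=.
by congr (V _ w < V _ w)%N; lia.
Qed.

End T_invariance.

(** With [F] the path plus [V] plus a function bounded by 1, [F] is within [V + 1] of the path. The
    successor in the hypothesis absorbs that function and forces the path to be unbounded even where
    [V] vanishes. *)
Lemma subcritical_carrier (R : realType) (eta : config) (V : int -> nat) :
  carrier_rule eta V ->
  (forall m : nat, exists N : nat, forall n : nat, (N <= n)%N ->
     m%:Z * (V n%:Z).+1%:Z <= `|path_enc eta n%:Z| /\
     m%:Z * (V (- n%:Z)).+1%:Z <= `|path_enc eta (- n%:Z)|) ->
  subcritical R (path_enc eta).
Proof.
move=> rule small.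
have pathS : is_path (path_enc eta).
  split; first exact: path_enc0.
  by move=> n; rewrite path_encB; case: (eta n); rewrite ?mulr1 ?mulr0.
pose g (n : int) : R := n%:~R / (1 + `|n|%:~R).
(* Adding the bounded increasing [g] makes the running maximum strictly increasing. *)
pose F (n : int) : R := (path_enc eta n + (V n)%:Z)%:~R + g n.
have den (n : int) : 0 < 1 + `|n|%:~R :> R by rewrite ltr_pwDl // ler0z.
have gmono : {homo g : m n / m < n}.
  move=> m n mn; rewrite /g ltr_pdivrMr // mulrAC ltr_pdivlMr //.
  have : m * (1 + `|n|) < n * (1 + `|m|) by nia.
  by rewrite -(ltr_int R) !rmorphM !rmorphD.
have g1 n : `|g n| <= 1.
  by rewrite /g normrM normfV (gtr0_norm (den n)) ler_pdivrMr // mul1r -intr_norm lerDr.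
have Fmono : {homo F : m n / m < n}.
  move=> m n mn; apply: ler_ltD; last exact: gmono.
  by rewrite ler_int; exact: (carrier_rule_homo rule (ltW mn)).
suff lim (u : nat -> int) : (forall m : nat, exists N : nat, forall n : nat, (N <= n)%N ->
     m%:Z * (V (u n)).+1%:Z <= `|path_enc eta (u n)|) ->
    (fun n => (path_enc eta (u n))%:~R / F (u n)) @ \oo --> (1 : R).
  split; split=> //; exists F; split=> //; apply: lim => m;
    by have [N NP] := small m; exists N => n /NP[].
move=> smallu; apply/cvgrPdist_le => e e0.
(* The summand 1 pays for passing from the size of the path to that of [F], by the triangle
   inequality. *)
have [m me] : exists m : nat, e^-1 + 1 <= m%:R.
  exists (Num.bound (e^-1 + 1)); apply: ltW; apply: le_lt_trans (archi_boundP _).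
    by rewrite lexx.
  by rewrite addr_ge0 // invr_ge0 ltW.
have [N NP] := smallu m; exists N => // n /= /NP mV.
set x : R := (path_enc eta (u n))%:~R; set v : R := (V (u n))%:R.
have v0 : 0 < v + 1 by rewrite ltr_wpDl // /v ler0n.
have FE : F (u n) = x + v + g (u n) by rewrite /F rmorphD.
have xF : `|F (u n) - x| <= v + 1.
  rewrite FE (_ : _ - x = v + g (u n)); last by ring.
  rewrite (le_trans (ler_normD _ _)) //.
  by rewrite lerD // /v normr_nat.
have xv : m%:R * (v + 1) <= `|x|.
  by move: mV; rewrite -(ler_int R) rmorphM /=
    -[X in _ * X]/((V (u n)).+1%:R) -addn1 natrD intr_norm.
have Fv : e^-1 * (v + 1) <= `|F (u n)|.
  have := ler_distD (F (u n)) x 0; rewrite !subr0 [X in X + _]distrC => tri.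
  have : (e^-1 + 1) * (v + 1) <= m%:R * (v + 1) by rewrite ler_wpM2r // ltW.
  by lra.
have F0 : 0 < `|F (u n)| by rewrite (lt_le_trans _ Fv) // mulr_gt0 // invr_gt0.
have -> : 1 - x / F (u n) = (F (u n) - x) / F (u n).
  by rewrite mulrBl divff // -normr_gt0.
rewrite normrM normfV ler_pdivrMr // (le_trans xF) //.
by rewrite -(ler_pM2l (_ : 0 < e^-1)) ?invr_gt0 // mulKf // gt_eqF.
Qed.

(** * Stationary Markov chains *)

Section stationary_chains.
Context (R : realType) d (Omega : measurableType d) (P : probability Omega R).

Lemma dmeas_RV d' (T : measurableType d') (X : {RV P >-> T}) : discrete T -> dmeas X.
Proof. by move=> dT; apply: discrete_dmeas => //; exact: measurable_funP. Qed.

Lemma stationary_prb d' (T : measurableType d') (X : int -> {RV P >-> T}) (k : int)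
    (A : set (zseq T)) : stationary X -> measurable A ->
  prb P [set w | A (process (fun n => X (n + k)) w)] = prb P [set w | A (process X w)].
Proof. by move=> statX mA; have [_ _ /(_ A mA) E] := statX k; congr fine; exact: E. Qed.

Lemma stationary_one d' (T : measurableType d') (X : int -> {RV P >-> T}) n (B : set T) :
  stationary X -> measurable B ->
  prb P [set w | B (X n w)] = prb P [set w | B (X 0 w)].
Proof.
move=> statX mB; have mA : measurable [set z : zseq T | B (z 0)].
  by rewrite -[X in measurable X]setTI; exact: (measurable_coord 0 measurableT mB).
by rewrite -(stationary_prb n statX mA) /process /= add0r.
Qed.

Lemma markov_prb d' (T : measurableType d') (Q : T -> T -> R) (X : int -> {RV P >-> T}) :
  discrete T -> markov_chain Q X ->
  forall n k x, prb P (window_event X n k.+1 x) =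
                prb P (window_event X n k x) * Q (x k) (x k.+1).
Proof.
move=> dT markX n k x; have mX i := dmeas_RV (X i) dT; apply: EFin_inj.
rewrite EFinM -!prbE; try exact: measurable_window.
exact: markX.
Qed.

Lemma window_event0 T (X : int -> Omega -> T) n x :
  window_event X n 0 x = [set w | X n w = x 0%N].
Proof.
apply/seteqP; split=> w /=; first by move=> /(_ 0%N isT); rewrite addr0.
by move=> wx [|//] _; rewrite addr0.
Qed.

Lemma window_event1 T (X : int -> Omega -> T) n x :
  window_event X n 1 x = [set w | X n w = x 0%N /\ X (n + 1) w = x 1%N].
Proof.
apply/seteqP; split=> w /=.
  move=> wx; split; last exact: (wx 1%N).
  by have := wx 0%N isT; rewrite addr0.
by move=> [wx wy] [|[|//]] _; rewrite ?addr0.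
Qed.

Lemma markov_pair T (Q : T -> T -> R) (X : int -> Omega -> T) :
  (forall n k x, prb P (window_event X n k.+1 x) =
                 prb P (window_event X n k x) * Q (x k) (x k.+1)) ->
  forall n x y, prb P [set w | X n w = x /\ X (n + 1) w = y] =
                prb P [set w | X n w = x] * Q x y.
Proof.
move=> XQ n x y; pose xy i := if i is 0%N then x else y.
by have := XQ n 0%N xy; rewrite window_event1 window_event0.
Qed.

Lemma flux (V0 V1 : Omega -> nat) (k : nat) : dmeas V0 -> dmeas V1 ->
  prb P [set w | (V0 w <= k)%N] = prb P [set w | (V1 w <= k)%N] ->
  {ae P, forall w, (V1 w <= (V0 w).+1)%N /\ (V0 w <= (V1 w).+1)%N} ->
  prb P [set w | V0 w = k /\ V1 w = k.+1] = prb P [set w | V0 w = k.+1 /\ V1 w = k].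
Proof.
move=> mV0 mV1 eqk step.
have mV (B : set (nat * nat)) : measurable [set w | B (V0 w, V1 w)].
  exact: (dmeas_pair mV0 mV1 B).
have m0 := mV [set v | (v.1 <= k)%N]; have m1 := mV [set v | (v.2 <= k)%N].
have mu := mV [set v | v.1 = k /\ v.2 = k.+1]; have md := mV [set v | v.1 = k.+1 /\ v.2 = k].
have up : prb P [set w | V0 w = k /\ V1 w = k.+1] =
    prb P ([set w | (V0 w <= k)%N] `&` ~` [set w | (V1 w <= k)%N]).
  apply: prb_ae => //; first by apply: measurableI => //; exact: measurableC.
  apply: filterS step => w [s1 s2] /=; split=> [[-> ->]|[le0 /negP lt1]]; [by split; lia|lia].
have down : prb P [set w | V0 w = k.+1 /\ V1 w = k] =
    prb P ([set w | (V1 w <= k)%N] `&` ~` [set w | (V0 w <= k)%N]).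
  apply: prb_ae => //; first by apply: measurableI => //; exact: measurableC.
  apply: filterS step => w [s1 s2] /=; split=> [[-> ->]|[le0 /negP lt1]]; [by split; lia|lia].
have := prb_split P m0 m1; have := prb_split P m1 m0.
by rewrite up down eqk setIC => -> /addrI.
Qed.

End stationary_chains.

(** * The conditioned configuration *)

(** Transfer matrix of one letter: [true] keeps the up-steps, [false] the down-steps and the flat
    step. *)
Definition carrier_step (R : realType) (p : R) (K : nat) (b : bool) : 'M[R]_K.+1 :=
  \matrix_(v, w) (carrier_matrix_trunc p K v w * (b == (w == v.+1 :> nat))%:R).

(** The powers of [p / (1 - p)] are the reversing weights of the carrier matrix, so they turn its
    right eigenvectors into left ones. *)
Definition carrier_left_eigenvector (R : realType) (p : R) (K : nat) (h : 'cV[R]_K.+1) :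
    'cV[R]_K.+1 :=
  \col_v ((p / (1 - p)) ^+ v * h v 0).

Section truncated_carrier_matrix.
Context (R : realType) (p lambda : R) (K : nat) (h : 'cV[R]_K.+1).
Hypotheses (p0 : 0 < p) (p1 : p < 1) (l0 : 0 < lambda).
Let A := carrier_matrix_trunc p K.
Hypothesis Ah : A *m h = lambda *: h.
Hypothesis h0 : forall x, 0 < h x 0.

Let step := carrier_step p K.

Let m (v : nat) : R := (p / (1 - p)) ^+ v.
Let g := carrier_left_eigenvector p h.

(* The antitriangular matrix [Psi] turns each [step b] into a symmetric matrix and
   maps the left eigenvector [g] to a multiple of [h]; transposition then reverses
   words in the [step b]. *)
Let Psi : 'M[R]_K.+1 := \matrix_(v, w) (v + w <= K)%N%:R.

Let q0 : 0 < 1 - p. Proof. by rewrite subr_gt0. Qed.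

Let AE v w : A v w = if w == v.+1 :> nat then p else (w == v.-1 :> nat)%:R * (1 - p).
Proof.
rewrite mxE /carrier_matrix; case: ifPn => // wv; case: ifPn => [/eqP ->|vw].
  by rewrite eqxx mul1r.
case: ifPn => [/andP[/eqP -> /eqP ->]|vw0]; first by rewrite mul1r.
by rewrite (_ : _ == _ = false) ?mul0r //; apply/negbTE; lia.
Qed.

Let A_row (f : 'I_K.+1 -> R) v : \sum_w A v w * f w =
  (if (v < K)%N then p * f (inord v.+1) else 0) + (1 - p) * f (inord v.-1).
Proof.
have lev : (v <= K)%N by rewrite -ltnS.
have predE : nat_of_ord (inord v.-1 : 'I_K.+1) = v.-1 by rewrite inordK //; lia.
have -> : \sum_w A v w * f w = \sum_(w : 'I_K.+1 | w == v.+1 :> nat) p * f w +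
    \sum_(w : 'I_K.+1 | w == v.-1 :> nat) (1 - p) * f w.
  rewrite [X in _ = X + _]big_mkcond [X in _ = _ + X]big_mkcond -big_split /=.
  apply: eq_bigr => w _; rewrite AE; case: eqP => [->|_].
    by rewrite (_ : _ == _ = false) ?addr0 //; apply/negbTE; lia.
  by rewrite add0r; case: ifP; rewrite ?mul1r ?mul0r.
congr (_ + _); last first.
  by rewrite (big_pred1 (inord v.-1)) // => w; rewrite /= -val_eqE /= predE.
case: ifPn => [vK|nvK].
  by rewrite (big_pred1 (inord v.+1)) // => w; rewrite /= -val_eqE /= inordK.
by rewrite big_pred0 // => w; apply/negbTE; have := ltn_ord w; lia.
Qed.

Let step_Psi b : (step b *m Psi)^T = step b *m Psi.
Proof.
have stepE v w : (step b *m Psi) v w = if b then p * (v + w < K)%N%:R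
    else (1 - p) * (v.-1 + w <= K)%N%:R.
  rewrite mxE; have lev : (v <= K)%N by rewrite -ltnS.
  have -> : \sum_u step b v u * Psi u w =
     \sum_u A v u * ((b == (u == v.+1 :> nat))%:R * Psi u w).
    by apply: eq_bigr => u _; rewrite mxE mulrA.
  rewrite (A_row (fun u => (b == (u == v.+1 :> nat))%:R * Psi u w)) !mxE.
  have predE : nat_of_ord (inord v.-1 : 'I_K.+1) = v.-1 by rewrite inordK //; lia.
  rewrite predE (_ : v.-1 == v.+1 = false); last by apply/negbTE; lia.
  case: ifPn => vK.
    by rewrite inordK // eqxx; case: b => /=; rewrite ?mul1r ?mul0r ?mulr0 ?addr0 ?add0r.
  case: b => /=; rewrite ?mul1r ?mul0r ?mulr0 ?add0r // (_ : (_ < K)%N = false) ?mulr0 //.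
  by apply/negbTE; lia.
apply/matrixP => v w; rewrite mxE !stepE addnC; case: (b) => //.
(* The truncation matters only when [v] or [w] is 0, and then both inequalities hold because indices
   are at most [K]. *)
congr (_ * _%:R); have := ltn_ord v; have := ltn_ord w.
by rewrite !ltnS => wK vK; congr nat_of_bool; apply/idP/idP; lia.
Qed.

Let stepD : step true + step false = A.
Proof.
by apply/matrixP => v w; rewrite !mxE -mulrDr; case: (w == v.+1 :> nat);
  rewrite /= ?addr0 ?add0r mulr1.
Qed.

Let Psi_sym : Psi^T = Psi.
Proof. by apply/matrixP => v w; rewrite !mxE addnC. Qed.

Let step_comm b : Psi *m (step b)^T = step b *m Psi.
Proof. by rewrite -step_Psi trmx_mul Psi_sym. Qed.

(** The matrix is tridiagonal: since [p] is nonzero, row [k] yields entry [k + 1] from entries [k]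
    and [k - 1]. In row 0 the predecessor is 0 itself, so entry 0 determines all the others. *)
Let eigen_unique (f : 'cV[R]_K.+1) : A *m f = lambda *: f ->
  f = (f ord0 0 / h ord0 0) *: h.
Proof.
move=> Af; set c := _ / _.
have row (e : 'cV[R]_K.+1) (v : 'I_K.+1) : A *m e = lambda *: e ->
    (if (v < K)%N then p * e (inord v.+1) 0 else 0) + (1 - p) * e (inord v.-1) 0 = lambda * e v 0.
  move=> Ae; have : (A *m e) v 0 = lambda * e v 0 by rewrite Ae mxE.
  by rewrite mxE (A_row (fun w => e w 0)).
suff both k : (k <= K)%N -> f (inord k) 0 = c * h (inord k) 0 /\
    f (inord k.-1) 0 = c * h (inord k.-1) 0.
  apply/colP => v; rewrite mxE; have [] := both v; first by rewrite -ltnS.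
  by rewrite inord_val.
elim: k => [_|k IH kK].
  have E : inord 0 = ord0 :> 'I_K.+1 by apply: val_inj; rewrite /= inordK.
  by rewrite E /c divfK // gt_eqF.
have [IH1 IH2] := IH (ltnW kK); split=> //.
have := row f (inord k) Af; have := row h (inord k) Ah.
rewrite inordK ?ltnS ?(ltnW kK) // kK IH1 IH2 => hrow frow.
apply: (mulfI (lt0r_neq0 p0)); rewrite mulrCA.
have -> : p * h (inord k.+1) 0 = lambda * h (inord k) 0 - (1 - p) * h (inord k.-1) 0.
  by rewrite -hrow addrK.
by rewrite -[LHS](addrK ((1 - p) * (c * h (inord k.-1) 0))) frow; ring.
Qed.

Let A_g : A^T *m g = lambda *: g.
Proof.
have balance (v w : 'I_K.+1) : m w * A w v = m v * A v w.
  rewrite !AE; have [wv|wv] := eqVneq (w : nat) v.+1.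
    rewrite wv (_ : _ == _ = false); last by apply/negbTE; lia.
    rewrite eqxx mul1r /m exprS -mulrA mulrCA; congr (_ * _).
    by rewrite -mulrA mulVf ?mulr1 // gt_eqF.
  have [vw|vw] := eqVneq (v : nat) w.+1.
    rewrite vw eqxx mul1r /m exprS -mulrA mulrCA; congr (_ * _).
    by rewrite mulrAC -mulrA mulfV ?mulr1 // gt_eqF.
  have [->//|nvw] := eqVneq v w.
  have nvw' : v <> w :> nat by move=> /val_inj /eqP; rewrite (negbTE nvw).
  have -> : (w == v.-1 :> nat) = false by apply/negbTE/eqP; lia.
  have -> : (v == w.-1 :> nat) = false by apply/negbTE/eqP; lia.
  by rewrite !mul0r !mulr0.
apply/colP => v; rewrite mxE.
have -> : \sum_w A^T v w * g w 0 = m v * \sum_w A v w * h w 0.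
  by rewrite mulr_sumr; apply: eq_bigr => w _; rewrite [A^T v w]mxE [g w 0]mxE mulrA
    [A w v * _]mulrC balance -mulrA.
have : (A *m h) v 0 = lambda * h v 0 by rewrite Ah mxE.
by rewrite mxE => ->; rewrite !mxE mulrCA.
Qed.

(** Summing the intertwining over both letters shows that [Psi *m g] is a right eigenvector, hence a
    multiple of [h]. The factor is nonzero because the first row of [Psi] is nonnegative with a
    positive leading entry, and [g] is positive. *)
Let Psi_g : exists2 c, c != 0 & Psi *m g = c *: h.
Proof.
have g0 v : 0 < g v 0 by rewrite mxE mulr_gt0 // exprn_gt0 // divr_gt0.
have APsi : A *m Psi = Psi *m A^T.
  by rewrite -stepD linearD /= mulmxDr !step_comm mulmxDl.
have /eigen_unique E : A *m (Psi *m g) = lambda *: (Psi *m g).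
  by rewrite mulmxA APsi -mulmxA A_g -scalemxAr.
exists ((Psi *m g) ord0 0 / h ord0 0) => //.
rewrite mulf_neq0 ?invr_eq0 ?gt_eqF // mxE (bigD1 ord0) //= ltr_pwDl //.
  by rewrite mxE /= mul1r.
by apply: sumr_ge0 => v _; apply: mulr_ge0; [rewrite mxE ler0n|exact: ltW].
Qed.

Let word_rev k (x : nat -> bool) :
  Psi *m (\prod_(i < k) step (x i))^T = (\prod_(i < k) step (x (k.-1 - i)%N)) *m Psi.
Proof.
elim: k => [|k IH]; first by rewrite !big_ord0 trmx1 mulmx1 mul1mx.
rewrite big_ord_recr big_ord_recl /= trmx_mul mulmxA step_comm -mulmxA IH.
rewrite subn0 -mulmxA; congr (_ *m (_ *m _)); apply: eq_bigr => i _.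
by congr (step (x _)); rewrite /bump /=; have := ltn_ord i; lia.
Qed.

(** With [c *: h] written as [Psi *m g], each side is a bilinear form evaluated at [g] twice. A
    matrix of size one equals its transpose, and transposing reverses the word. *)
Lemma carrier_word_rev k (x : nat -> bool) :
  g^T *m (\prod_(i < k) step (x i)) *m h =
  g^T *m (\prod_(i < k) step (x (k.-1 - i)%N)) *m h.
Proof.
have [c c0 Psig] := Psi_g; apply: (scalerI c0).
have tr11 (B : 'M[R]_1) : B^T = B by rewrite [B]mx11_scalar tr_scalar_mx.
rewrite !scalemxAr -Psig -[LHS]tr11 !trmx_mul trmxK Psi_sym.
by rewrite !mulmxA -(mulmxA g^T) word_rev !mulmxA.
Qed.

End truncated_carrier_matrix.

(** * The stationary bounded carrier and its up-steps *)

Section conditioned_configuration.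
Context (R : realType) d (Omega : measurableType d) (P : probability Omega R).
Context (p lambda : R) (K : nat) (h : 'cV[R]_K.+1).
Hypotheses (p0 : 0 < p) (p1 : p < 1) (l0 : 0 < lambda).
Let A := carrier_matrix_trunc p K.
Hypothesis Ah : A *m h = lambda *: h.
Hypothesis h0 : forall x, 0 < h x 0.
Context (W : int -> {RV P >-> 'I_K.+1}).
Let Q := doob_transform A lambda h.
Hypothesis markW : markov_chain Q W.
Hypothesis statW : stationary W.

Let pi (x : 'I_K.+1) : R := prb P [set w | W 0 w = x].
Let eta n w := up_steps W w n.
Let V n w : nat := W n w.

Let q0 : 0 < 1 - p. Proof. by rewrite subr_gt0. Qed.

Let mW n : dmeas (W n). Proof. exact: (dmeas_RV _ (discrete_ord K)). Qed.

Let mV n : dmeas (V n). Proof. exact: (dmeas_comp _ (mW n)). Qed.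

Let meta n : dmeas (eta n).
Proof. exact: (dmeas2 (fun x y => x == y.+1) (mV n) (mV (n - 1))). Qed.

Let WQ := markov_prb (discrete_ord K) markW.

Let piE n x : prb P [set w | W n w = x] = pi x.
Proof. exact: (stationary_one n (B := [set x]) statW). Qed.

Let W2 n x y : prb P [set w | W n w = x /\ W (n + 1) w = y] = pi x * Q x y.
Proof. by rewrite (markov_pair WQ) piE. Qed.

Let m2 n n' (B : set ('I_K.+1 * 'I_K.+1)) : measurable [set w | B (W n w, W n' w)].
Proof. exact: (dmeas_pair (mW n) (mW n') B). Qed.

Let A_gt0 (x y : 'I_K.+1) : y = x.+1 :> nat \/ y = x.-1 :> nat -> 0 < A x y.
Proof.
move=> xy; rewrite mxE /carrier_matrix.
case: eqP => // yx; case: eqP => // xy1; case: ifPn => // /negP; case.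
by apply/andP; split; apply/eqP; lia.
Qed.

Let A_eq0 (x y : 'I_K.+1) : ~ (y = x.+1 :> nat \/ y = x.-1 :> nat) -> A x y = 0.
Proof.
move=> xy; rewrite mxE /carrier_matrix; case: eqP => yx; first by lia.
by case: eqP => xy1; first lia; case: ifPn => // /andP[/eqP ? /eqP ?]; lia.
Qed.

Let Q_ge0 x y : 0 <= Q x y.
Proof.
apply: divr_ge0; apply: mulr_ge0; do ?[exact: ltW].
have [/A_gt0|/A_eq0 ->] // := pselect (y = x.+1 :> nat \/ y = x.-1 :> nat).
exact: ltW.
Qed.

Let Q_gt0 (x y : 'I_K.+1) : y = x.+1 :> nat \/ y = x.-1 :> nat -> 0 < Q x y.
Proof. by move=> /A_gt0 Axy; rewrite /Q /doob_transform divr_gt0 ?mulr_gt0. Qed.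

Let WV n z (x : 'I_K.+1) : (W n z = x) = (V n z = x :> nat).
Proof. by apply/propext; split=> [Wx|/val_inj //]; rewrite /V Wx. Qed.

Let ae_step n : {ae P, forall w, V n w = (V (n - 1) w).+1 \/ V n w = (V (n - 1) w).-1}.
Proof.
have : {ae P, forall w, forall xy : 'I_K.+1 * 'I_K.+1,
    ~ (xy.2 = xy.1.+1 :> nat \/ xy.2 = xy.1.-1 :> nat) ->
    ~ (W (n - 1) w = xy.1 /\ W n w = xy.2)}.
  apply: ae_forallC => -[x y] /=.
  have [xy|nxy] := pselect (y = x.+1 :> nat \/ y = x.-1 :> nat); first exact: aeW.
  suff : {ae P, forall w, ~ [set w | W (n - 1) w = x /\ W n w = y] w} by apply: filterS => w.
  apply: ae_prb0; first exact: (m2 (n - 1) n [set xy | xy.1 = x /\ xy.2 = y]).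
  by have := W2 (n - 1) x y; rewrite subrK /Q /doob_transform A_eq0 // !mul0r mulr0.
by apply: filterS => w /(_ (W (n - 1) w, W n w)) /= Hw; apply: contrapT => /Hw; apply.
Qed.

Let rule : {ae P, forall w, carrier_rule (fun n => eta n w) (fun n => V n w)}.
Proof.
apply: ae_forallC => n; apply: filterS (ae_step n) => w.
by rewrite /eta /up_steps -/(V n w) -/(V (n - 1) w); case: eqP => [|ne [|]].
Qed.

Let balance x y : pi x * Q x y = pi y * Q y x.
Proof.
have up (v w : 'I_K.+1) : w = v.+1 :> nat -> pi v * Q v w = pi w * Q w v.
  move=> wv; rewrite -(W2 0 v w) -(W2 0 w v).
  have -> : [set z | W 0 z = v /\ W (0 + 1) z = w] = [set z | V 0 z = v /\ V (0 + 1) z = v.+1].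
    by apply/seteqP; split=> z /=; rewrite !WV wv.
  have -> : [set z | W 0 z = w /\ W (0 + 1) z = v] = [set z | V 0 z = v.+1 /\ V (0 + 1) z = v].
    by apply/seteqP; split=> z /=; rewrite !WV wv.
  apply: flux => //.
    exact/esym/(stationary_one (0 + 1) (B := [set x : 'I_K.+1 | (x <= v)%N]) statW).
  by apply: filterS (ae_step (0 + 1)) => z; rewrite addrK; move: (V _ z) (V 0 z) => a b; lia.
have [xy|nxy] := eqVneq (y : nat) x.+1; first exact: up.
have [yx|nyx] := eqVneq (x : nat) y.+1; first exact/esym/up.
have [->//|] := eqVneq x y; rewrite -val_eqE /= => nex.
by rewrite /Q /doob_transform !A_eq0 ?mul0r ?mulr0 //; lia.
Qed.

Let revW : eq_in_law P (process W) (process (fun n => W (- n))).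
Proof.
have := @reversible_law _ _ _ P _ _ W Q pi id 0 (discrete_ord K) _ mW WQ piE _ balance.
rewrite (_ : (fun n : int => id \o W (0 - n)) = fun n => W (- n) : Omega -> _).
  by apply.
by apply/funext => n; rewrite sub0r.
Qed.

(** Flat steps rather than visits to 0 are followed, because only they raise the running maximum. *)
Let flat (z : zseq 'I_K.+1) (n : int) : Prop := z (n - 1) = ord0 /\ z n = ord0.

Let noflat (N : int) : set (zseq 'I_K.+1) := [set z | forall n : int, n <= N -> ~ flat z n].

Let mflat n : measurable [set z : zseq 'I_K.+1 | flat z n].
Proof.
have mc i : dmeas (coord i : zseq 'I_K.+1 -> _).
  exact: (discrete_dmeas (discrete_ord K) (measurable_coord i)).
by apply: measurableI; [exact: (mc _ [set ord0])|exact: (mc _ [set ord0])].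
Qed.

Let mnoflat N : measurable (noflat N).
Proof.
apply: measurable_forallC => n; apply: measurable_imply => _.
by apply: measurableC; exact: mflat.
Qed.

Let E (N : int) : set Omega := [set w | noflat N (process W w)].

Let mE N : measurable (E N).
Proof.
rewrite -[X in measurable X]setTI.
exact: (measurable_process mW measurableT (mnoflat N)).
Qed.

Let E_shift N : prb P (E (N + 1)) = prb P (E N).
Proof.
rewrite -(stationary_prb 1 statW (mnoflat N)); congr prb.
apply/seteqP; split=> w nf n nN [f1 f2].
  by apply: (nf (n + 1)); [rewrite lerD2r|split; [rewrite -f1|rewrite -f2]; congr (W _ w); lia].
by apply: (nf (n - 1)); [lia|split; [rewrite -f1|rewrite -f2]; congr (W _ w); lia].
Qed.

(* By stationarity [E N] and [E (N + 1)] differ by a null set, so on [E N] the chain a.s. does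
   not visit [0] at time [N] (else it would make a flat step with positive probability), hence
   not [1] either, and so on. *)
Let noflat_null N : prb P (E N) = 0.
Proof.
have E_loss (M : int) : prb P (E M `&` ~` E (M + 1)) = 0.
  have := prb_split P (mE M) (mE (M + 1)); rewrite (_ : E M `&` E (M + 1) = E (M + 1)).
    by rewrite E_shift => /eqP; rewrite -subr_eq0 opprD addNKr oppr_eq0 => /eqP.
  by apply: setIidr => w nf n nM; apply: nf; lia.
have mA (M : int) (B : set ('I_K.+1 * 'I_K.+1)) :
    measurable [set w | E M w /\ B (W M w, W (M + 1) w)].
  by apply: measurableI; [exact: mE|exact: m2].
have past (M : int) x y : prb P [set w | E M w /\ (W M w = x /\ W (M + 1) w = y)] =
    prb P [set w | E M w /\ W M w = x] * Q x y.
  apply: past_markov => //; first exact: discrete_ord.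
  move=> z z' zz' nf n nM [f1 f2]; apply: (nf n nM); split; rewrite zz' //.
  by lia.
have null (M : int) (x y : 'I_K.+1) : 0 < Q x y ->
    prb P [set w | E M w /\ (W M w = x /\ W (M + 1) w = y)] <= 0 ->
    prb P [set w | E M w /\ W M w = x] = 0.
  move=> Qxy; rewrite past pmulr_lle0 // => le0.
  by apply/eqP; rewrite eq_le le0 prb_ge0.
suff all0 k : (k <= K)%N -> forall M : int, prb P [set w | E M w /\ W M w = k :> nat] = 0.
  rewrite (prb_partition P (mE N) (mW N)) big1 // => x _.
  rewrite -(all0 x _ N); last by rewrite -ltnS.
  by congr prb; apply/seteqP; split=> w [Ew /= Wx]; split=> //; [rewrite /= Wx|exact: val_inj].
elim: k => [_|k IH kK] M.
  rewrite -(null M ord0 ord0) //.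
  - by congr prb; apply/seteqP; split=> w [Ew /= Wx]; split=> //; [exact: val_inj|rewrite Wx].
  - by apply: Q_gt0; right.
  rewrite -(E_loss M); apply: le_prb.
  - exact: (mA M [set xy | xy.1 = ord0 /\ xy.2 = ord0]).
  - by apply: measurableI => //; exact: measurableC.
  move=> w [Ew [W0 W1]]; split=> // /(_ (M + 1) (lexx _)); apply.
  by split; rewrite /process ?addrK.
have kE : nat_of_ord (inord k : 'I_K.+1) = k by rewrite inordK // ltnS ltnW.
have k1E : nat_of_ord (inord k.+1 : 'I_K.+1) = k.+1 by rewrite inordK.
rewrite -(null M (inord k.+1) (inord k)).
- by congr prb; apply/seteqP; split=> w [Ew /= Wx]; split=> //;
    [apply: val_inj; rewrite /= k1E|rewrite Wx k1E].
- by apply: Q_gt0; right; rewrite kE k1E.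
rewrite -(IH (ltnW kK) (M + 1)); apply: le_prb.
- exact: (mA M [set xy | xy.1 = inord k.+1 /\ xy.2 = inord k]).
- by apply: measurableI; [exact: mE|exact: (mW (M + 1) [set x | x = k :> nat])].
move=> w [Ew [W0 W1]]; split; last by rewrite /= W1 kE.
move=> n; rewrite le_eqVlt => /predU1P[->|nM].
  rewrite /flat /process addrK W0 => -[/(congr1 val)] /=; rewrite k1E.
  by [].
by apply: Ew; lia.
Qed.

Let flat_past : {ae P, forall w, forall N : int, exists n : int, n <= N /\ flat (process W w) n}.
Proof.
apply: ae_forallC => N; have := ae_prb0 (mE N) (noflat_null N).
apply: filterS => w nE; apply: contrapT => nf; apply: nE => n nN fn.
by apply: nf; exists n.
Qed.

(** Reversing [W] turns its future into its past and preserves flat steps. *)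
Let flat_future : {ae P, forall w, forall N : int, exists n : int, N <= n /\ flat (process W w) n}.
Proof.
apply: ae_forallC => N.
have mB : measurable [set z : zseq 'I_K.+1 | forall n : int, N <= n -> ~ flat z n].
  apply: measurable_forallC => n; apply: measurable_imply => _.
  by apply: measurableC; exact: mflat.
suff null : prb P [set w | forall n : int, N <= n -> ~ flat (process W w) n] = 0.
  have mB' : measurable [set w | forall n : int, N <= n -> ~ flat (process W w) n].
    rewrite -[X in measurable X]setTI.
    exact: (measurable_process mW measurableT mB).
  apply: filterS (ae_prb0 mB' null) => w nB; apply: contrapT => nf; apply: nB => n nN fn.
  by apply: nf; exists n.
have [_ _ /(_ _ mB) rev] := revW; rewrite -(noflat_null (1 - N)).
apply: etrans (congr1 fine rev) _; congr prb; apply/seteqP; split=> w nf n nN [f1 f2].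
  by apply: (nf (1 - n)); [lia|split; [rewrite -f2|rewrite -f1]; congr (W _ w); lia].
by apply: (nf (1 - n)); [lia|split; [rewrite -f2|rewrite -f1]; congr (W _ w); lia].
Qed.

Let L w n : int := path_enc (fun n => eta n w) n + (V n w)%:Z.

Lemma conditioned_subcritical :
  {ae P, forall w, subcritical R (path_enc (fun n => eta n w))}.
Proof.
apply: filterS3 rule flat_past flat_future => w rul past future.
have Lhomo : {homo L w : m n / m <= n} := carrier_rule_homo rul.
have Lflat n : flat (process W w) n -> L w (n - 1) + 1 = L w n.
  move=> [f1 f2]; have f1' : W (n - 1) w = ord0 := f1; have f2' : W n w = ord0 := f2.
  by rewrite /L (path_encS _ n) /V /eta /up_steps f1' f2' /= [RHS]addrAC.
have VK n : (V n w <= K)%N by rewrite /V -ltnS.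
have Lfut (B : nat) : exists N : int, forall n : int, N <= n -> B%:Z <= L w n.
  elim: B => [|B [N HN]].
    by exists 0 => n n0; apply: le_trans (Lhomo _ _ n0); rewrite /L path_enc0 add0r.
  have [n [nN fn]] := future (N + 1); exists n => k nk.
  apply: le_trans (Lhomo _ _ nk); rewrite -(Lflat _ fn) -addn1 PoszD lerD2r.
  by apply: HN; lia.
(* The offset [K] bounds [L w 0], which is [V 0 w]. *)
have Lpast (B : nat) : exists N : int, forall n : int, n <= N -> L w n <= K%:Z - B%:Z.
  elim: B => [|B [N HN]].
    exists 0 => n n0; apply: (le_trans (Lhomo _ _ n0)).
    by rewrite /L path_enc0 add0r subr0 lez_nat.
  have [n [nN fn]] := past N; exists (n - 1) => k nk.
  apply: (le_trans (Lhomo _ _ nk)); have := HN n nN; rewrite -(Lflat _ fn).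
  by move: (L w _) => l; lia.
apply: (@subcritical_carrier R _ _ rul) => m.
(* In the future the extra [K] pays for subtracting [V] from [L]; in the past it cancels the offset
   of [Lpast]. *)
have [N1 HN1] := Lfut (m * K.+1 + K)%N; have [N2 HN2] := Lpast (m * K.+1 + K)%N.
exists (absz N1 + absz N2)%N => n nN.
have mVK k : m%:Z * (V k w).+1%:Z <= m%:Z * K.+1%:Z.
  by rewrite -!PoszM lez_nat leq_mul // ltnS.
split; apply: (le_trans (mVK _)).
  have : (m * K.+1 + K)%:Z <= L w n by apply: HN1; lia.
  by have := VK n; rewrite /L PoszD PoszM; move: (path_enc _ _) (V _ _) (m%:Z * _) => a b c; lia.
have : L w (- n%:Z) <= K%:Z - (m * K.+1 + K)%:Z by apply: HN2; lia.
by rewrite /L PoszD PoszM; move: (path_enc _ _) (V _ _) (m%:Z * _) => a b c; lia.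
Qed.

Let g := carrier_left_eigenvector p h.
Let step := carrier_step p K.

(** Detailed balance between neighbouring levels fixes the ratio of successive values; the constant
    is read off at level 0, where [g] and [h] agree. *)
Let pi_g x : pi x = pi ord0 / h ord0 0 ^+ 2 * (g x 0 * h x 0).
Proof.
suff all k : (k <= K)%N -> let v := inord k : 'I_K.+1 in
    pi v = pi ord0 / h ord0 0 ^+ 2 * (g v 0 * h v 0).
  by have := all x; rewrite -ltnS inord_val; apply.
elim: k => [_|k IH kK] v'.
  have -> : v' = ord0 by apply: val_inj; rewrite /= inordK.
  by rewrite /g mxE expr0 mul1r -expr2 divfK // expf_neq0 // gt_eqF.
have kE : nat_of_ord (inord k : 'I_K.+1) = k by rewrite inordK // ltnS ltnW.
have k1E : nat_of_ord v' = k.+1 by rewrite inordK.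
have {IH} := IH (ltnW kK); set v := inord k => IH.
have A1 : A v v' = p by rewrite mxE /carrier_matrix k1E kE eqxx.
have A2 : A v' v = 1 - p.
  by rewrite mxE /carrier_matrix k1E kE eqxx; case: eqP => //; lia.
have := balance v v'; rewrite /Q /doob_transform A1 A2 IH /g !mxE k1E kE (exprS _ k).
have hv := lt0r_neq0 (h0 v); have hv' := lt0r_neq0 (h0 v').
have l1 := lt0r_neq0 l0; have q1 := lt0r_neq0 q0.
move: (pi v') (pi ord0 / _) ((p / (1 - p)) ^+ k) (h v 0) (h v' 0) (1 - p) hv hv' q1 l1
  => a b c s t q hs ht q1 l1 E0.
have -> : a = a * (q * s / (lambda * t)) * (lambda * t) / (q * s).
  by field; rewrite ?hs ?ht ?q1 ?l1.
by rewrite -E0; field; rewrite ?hs ?ht ?q1 ?l1.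
Qed.

(** The factors of the Doob transform telescope along a path: they leave [h] at its end, a power of
    [lambda], and an inverse [h] at its start, which reduces [pi] there to a multiple of [g]. The
    final state is recorded to make the induction go through. *)
Let word_law n k x v :
  prb P [set w | window_event eta (n + 1) k x w /\ W (n + 1 + k%:Z) w = v] =
  pi ord0 / h ord0 0 ^+ 2 * lambda ^- k.+1 *
    ((g^T *m \prod_(i < k.+1) step (x i)) 0 v * h v 0).
Proof.
pose up (z : zseq 'I_K.+1) i := z i == (z (i - 1)).+1 :> nat.
have mc i : dmeas (coord i : zseq 'I_K.+1 -> _).
  exact: (discrete_dmeas (discrete_ord K) (measurable_coord i)).
have mup i : dmeas (fun z => up z i).
  exact: (dmeas2 (fun a b : 'I_K.+1 => a == b.+1 :> nat) (mc i) (mc (i - 1))).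
have one_step N (B : set (zseq 'I_K.+1)) b u : measurable B ->
    (forall z z' : zseq 'I_K.+1, (forall i, i <= N -> z i = z' i) -> B z -> B z') ->
    prb P [set w | B (process W w) /\ (eta (N + 1) w = b /\ W (N + 1) w = u)] =
    \sum_v prb P [set w | B (process W w) /\ W N w = v] * (Q v u * (b == (u == v.+1 :> nat))%:R).
  move=> mB pastB.
  have mBw : measurable [set w | B (process W w)].
    rewrite -[X in measurable X]setTI; exact: (measurable_process mW measurableT mB).
  rewrite (prb_partition P _ (mW N)); last first.
    by apply: measurableI => //; apply: measurableI;
      [exact: (meta (N + 1) [set b])|exact: (mW (N + 1) [set u])].
  apply: eq_bigr => v' _; rewrite mulrA -(past_markov (discrete_ord K) mW Q_ge0 WQ mB pastB).
  have [bE|bE] := eqVneq b (u == v'.+1 :> nat).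
    rewrite mulr1; congr prb; apply/seteqP; split=> w /=; first by case=> -[? [? ?]] ?; split.
    by case=> ? [Wv Wu]; do !split=> //; rewrite /eta /up_steps addrK Wv Wu bE.
  rewrite mulr0 -(prb0 P); congr prb; rewrite -subset0 => w [[_ [e Wu]] Wv].
  by move/eqP: bE; apply; rewrite -e /eta /up_steps addrK Wu Wv.
have sum_step c (y : 'rV[R]_K.+1) b u :
    \sum_v (c * (y 0 v * h v 0)) * (Q v u * (b == (u == v.+1 :> nat))%:R) =
    c * lambda^-1 * ((y *m step b) 0 u * h u 0).
  rewrite mxE mulr_suml mulr_sumr; apply: eq_bigr => v' _.
  rewrite [step b v' u]mxE /Q /doob_transform -/A.
  have l1 := lt0r_neq0 l0; have hv := lt0r_neq0 (h0 v').
  move: (h v' 0) (h u 0) (A v' u) (y 0 v') (_%:R) hv l1 => s t a z e hs l1.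
  by field; rewrite ?hs ?l1.
elim: k v => [|k IH] v.
  rewrite big_ord1 -sum_step.
  have -> : [set w | window_event eta (n + 1) 0 x w /\ W (n + 1 + 0%:Z) w = v] =
      [set w | [set: zseq 'I_K.+1] (process W w) /\ (eta (n + 1) w = x 0%N /\ W (n + 1) w = v)].
    by rewrite window_event0 addr0; apply/seteqP; split=> w /= [? ?] //; do !split=> //; tauto.
  rewrite one_step //; apply: eq_bigr => u _; congr (_ * _).
  rewrite mxE -pi_g -(piE n); congr prb; apply/seteqP; split=> w //=; by case.
rewrite big_ord_recr /=.
have -> : g^T *m (\prod_(i < k.+1) step (x i) * step (x k.+1)) =
    (g^T *m \prod_(i < k.+1) step (x i)) *m step (x k.+1) by rewrite -mulmxA.
have -> : lambda ^- k.+2 = lambda ^- k.+1 / lambda by rewrite exprS invfM mulrC.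
rewrite [_ * (_ / lambda)]mulrA -sum_step.
pose N := n + 1 + k%:Z; pose B : set (zseq 'I_K.+1) :=
  [set z | forall i : nat, (i <= k)%N -> up z (n + 1 + i%:Z) = x i].
have mB : measurable B.
  apply: measurable_forallC => i; apply: measurable_imply => _.
  exact: (mup _ [set x i]).
have pastB (z z' : zseq 'I_K.+1) : (forall i : int, i <= N -> z i = z' i) -> B z -> B z'.
  by move=> zz' Bz i ik; rewrite -Bz // /up !zz' // /N; lia.
have -> : [set w | window_event eta (n + 1) k.+1 x w /\ W (n + 1 + k.+1%:Z) w = v] =
    [set w | B (process W w) /\ (eta (N + 1) w = x k.+1 /\ W (N + 1) w = v)].
  have NE : n + 1 + k.+1%:Z = N + 1 by rewrite /N; lia.
  apply/seteqP; split=> w /=; rewrite NE.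
    move=> [ww ->]; split; first by move=> i ik; exact: (ww i (leqW ik)).
    by split=> //; rewrite -NE; exact: ww.
  move=> [Bw [ew ->]]; split=> // i; rewrite leq_eqVlt => /predU1P[->|ik].
    by rewrite NE.
  exact: Bw.
rewrite one_step //; apply: eq_bigr => u _; congr (_ * _).
by rewrite -IH.
Qed.

Let word_law_rev n n' k x :
  prb P (window_event eta n k x) = prb P (window_event eta n' k (fun i => x (k - i)%N)).
Proof.
have closed i y : prb P (window_event eta i k y) =
    pi ord0 / h ord0 0 ^+ 2 * lambda ^- k.+1 *
    (g^T *m \prod_(i < k.+1) step (y i) *m h) 0 0.
  rewrite -(subrK 1 i) (prb_partition P (measurable_window _ _ _ discrete_bool meta)
    (mW (i - 1 + 1 + k%:Z))).
  by rewrite [in RHS]mxE mulr_sumr; apply: eq_bigr => v _; rewrite -(word_law (i - 1) k y v).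
rewrite !closed; congr (_ * _); congr (fun_of_matrix _ _ _).
exact: (carrier_word_rev p0 p1 l0 Ah h0 k.+1 x).
Qed.

Lemma conditioned_T_invariant : subcritical_and_T_invariant P (up_steps W).
Proof.
split; first exact: conditioned_subcritical.
apply: (@T_invariance _ _ _ P eta V) => //.
- apply: filterS flat_past => w past N; have [n [nN [_ fn]]] := past N.
  by exists n; split=> //; rewrite /V; have := congr1 val fn.
- pose values (z : zseq 'I_K.+1) : zseq nat := fun n => val (z n).
  have mval : measurable_fun setT values.
    apply: measurable_zseq => n; apply: dmeas_measurable_fun.
    apply: (dmeas_comp val).
    exact: (discrete_dmeas (discrete_ord K) (measurable_coord n)).
  exact: (eq_in_law_comp mval revW).
apply: (eq_in_law_windows discrete_bool) => // M x.
rewrite (word_law_rev _ (1 - M%:Z)); congr prb; apply/seteqP; split=> w ww i iM /=.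
  rewrite -[in RHS](subKn iM) (_ : 1 - _ = 1 - M%:Z + (M.*2 - i)%N%:Z); last by lia.
  by rewrite ww ?leq_subr.
by rewrite -(ww (M.*2 - i)%N) ?leq_subr //=; congr (eta _ w); lia.
Qed.

End conditioned_configuration.

(** * Exponential tails *)

Section geometric_tails.
Context (R : realType) d (Omega : measurableType d) (P : probability Omega R).

Lemma prb_geometric_union (a r : R) (B : nat -> set Omega) : 0 <= r < 1 ->
  (forall j, measurable (B j)) -> (forall j, prb P (B j) <= a * r ^+ j) ->
  prb P (\bigcup_j B j) <= a / (1 - r).
Proof.
move=> /andP[r0 r1] mB BP.
have q0 : 0 < 1 - r by rewrite subr_gt0.
have a0 : 0 <= a by have := BP 0%N; rewrite expr0 mulr1; apply: le_trans; exact: prb_ge0.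
pose U n := \big[setU/set0]_(j < n) B j.
have mU n : measurable (U n) by apply: bigsetU_measurable => i _.
have UP n : prb P (U n) <= a * (1 - r ^+ n) / (1 - r).
  elim: n => [|n IH]; first by rewrite /U big_ord0 prb0 expr0 subrr mulr0 mul0r.
  have -> : a * (1 - r ^+ n.+1) / (1 - r) = a * (1 - r ^+ n) / (1 - r) + a * r ^+ n.
    by rewrite exprS; field; rewrite gt_eqF.
  rewrite /U big_ord_recr /= -/(U n); apply: (le_trans _ (lerD IH (BP n))).
  rewrite -lee_fin EFinD -!prbE //; last exact: measurableU.
  exact: measureU2.
have mUB : measurable (\bigcup_j B j) by exact: bigcupT_measurable.
have UB : \bigcup_n U n = \bigcup_j B j.
  apply/seteqP; split=> [w [n _]|w [j _ Bj]].
    by rewrite /U -bigcup_mkord => -[j _ Bj]; exists j.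
  by exists j.+1 => //; rewrite /U -bigcup_mkord; exists j => /=.
rewrite -lee_fin -prbE // -UB.
have cvgU : (P \o U) x @[x --> \oo] --> P (\bigcup_n U n).
  apply: nondecreasing_cvg_mu => //; first by rewrite UB.
  move=> n m nm; rewrite subsetEset /U -!bigcup_mkord => w [j /= jn Bj].
  by exists j => //=; exact: leq_trans jn nm.
rewrite -(cvg_lim _ cvgU) //; apply: lime_le; first by apply/cvg_ex; eexists; exact: cvgU.
near=> n; rewrite /= prbE // lee_fin (le_trans (UP n)) //.
by rewrite ler_pM2r ?invr_gt0 // ler_piMr // gerBl exprn_ge0.
Unshelve. all: by end_near. Qed.

Lemma ge0_geometric_le0 (c r x : R) : 0 <= r < 1 -> (forall n, x <= c * r ^+ n) -> x <= 0.
Proof.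
move=> /andP[r0 r1] xc.
have lim : (fun n => c * r ^+ n) @ \oo --> (0 : R).
  rewrite -(mulr0 c); apply: cvgM; first exact: cvg_cst.
  by apply: cvg_expr; rewrite ger0_norm.
rewrite -(cvg_lim _ lim) //; apply: limr_ge; first by apply/cvg_ex; eexists; exact: lim.
by apply: nearW => n.
Qed.

Lemma geometric_borel_cantelli (a r : R) (B : nat -> set Omega) : 0 <= r < 1 ->
  (forall j, measurable (B j)) -> (forall j, prb P (B j) <= a * r ^+ j) ->
  {ae P, forall w, exists N, forall j, (N <= j)%N -> ~ B j w}.
Proof.
move=> r01 mB BP.
pose bad := [set w | forall N, exists j, (N <= j)%N /\ B j w].
have mbad : measurable bad.
  apply: measurable_forallC => N; apply: measurable_existsC => j.
  by apply: measurableI => //; exact: (@dmeas_cst _ Omega _ j [set j | (N <= j)%N]).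
have bad0 : prb P bad = 0.
  apply/eqP; rewrite eq_le prb_ge0 andbT.
  apply: (@ge0_geometric_le0 (a / (1 - r)) r) => // N.
  have mshift j : measurable (B (N + j)%N) by [].
  have := @prb_geometric_union (a * r ^+ N) r (fun j => B (N + j)%N) r01 mshift.
  rewrite mulrAC => union; apply: le_trans (union _); last first.
    by move=> j; rewrite -mulrA -exprD.
  apply: le_prb => //; first exact: bigcupT_measurable.
  by move=> w /(_ N)[j [Nj Bj]]; exists (j - N)%N; rewrite // subnKC.
apply: filterS (ae_prb0 mbad bad0) => w nbad; apply: contrapT => nex.
apply: nbad => N; apply: contrapT => nj; apply: nex; exists N => j Nj Bj.
by apply: nj; exists j.
Qed.

End geometric_tails.

(** The index follows [window_event], whose parameter [k] spans [k + 1] sites; words grow at the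
    end, as time does. *)
Fixpoint bit_words (k : nat) : seq (seq bool) :=
  if k is k'.+1 then [seq rcons s b | s <- bit_words k', b <- [:: false; true]]
  else [:: [:: false]; [:: true]].

Lemma bit_wordsS k :
  bit_words k.+1 = [seq rcons s b | s <- bit_words k, b <- [:: false; true]].
Proof. by []. Qed.

Section exponential_moment.
Context (R : realType) d (Omega : measurableType d) (P : probability Omega R).
Context (Q : bool -> bool -> R) (eta : int -> Omega -> bool).
Hypothesis meta : forall n, dmeas (eta n).
Hypothesis etaQ : forall n k x, prb P (window_event eta n k.+1 x) =
                                prb P (window_event eta n k x) * Q (x k) (x k.+1).
Context (a v : bool -> R) (r : R).
Hypothesis r0 : 0 <= r.
Hypotheses (a0 : forall b, 0 < a b) (v0 : forall b, 0 < v b).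
Hypothesis superharmonic : forall b, \sum_c Q b c * a c * v c <= r * v b.

Let mwin n k x : measurable (window_event eta n k x).
Proof. exact: measurable_window discrete_bool meta. Qed.

Let size_words k s : s \in bit_words k -> size s = k.+1.
Proof.
elim: k s => [|k IH] s; first by rewrite !inE => /orP[/eqP->|/eqP->].
by rewrite bit_wordsS => /allpairsPdep[t [b [/IH st _ ->]]]; rewrite size_rcons st.
Qed.

Let window_rcons n k s b : size s = k.+1 ->
  window_event eta n k (nth false (rcons s b)) = window_event eta n k (nth false s).
Proof.
by move=> sk; apply/seteqP; split=> w ww i ik; have := ww i ik; rewrite nth_rcons sk ltnS ik.
Qed.

Let window_rconsS n k s b : size s = k.+1 ->
  window_event eta n k.+1 (nth false (rcons s b)) =
  window_event eta n k (nth false s) `&` eta (n + k.+1%:Z) @^-1` [set b].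
Proof.
move=> sk; rewrite -(window_rcons n b sk); apply/seteqP; split=> [w ww|w [ww /= wb] i].
  split; first by move=> i ik; apply: ww; exact: leqW.
  by have := ww k.+1 (leqnn _); rewrite nth_rcons sk ltnn eqxx.
rewrite leq_eqVlt => /predU1P[->|]; first by rewrite wb nth_rcons sk ltnn eqxx.
exact: ww.
Qed.

Let prb_words n k A : measurable A ->
  prb P A = \sum_(s <- bit_words k) prb P (A `&` window_event eta n k (nth false s)).
Proof.
move=> mA; elim: k => [|k IH].
  rewrite (prb_partition P mA (meta n)) big_bool big_cons big_seq1 addrC.
  by congr (_ + _); congr prb; rewrite window_event0.
rewrite bit_wordsS big_allpairs_dep IH [LHS]big_seq [RHS]big_seq.
apply: eq_bigr => s /size_words sk.
rewrite (prb_partition P _ (meta (n + k.+1%:Z))); last exact: measurableI.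
rewrite big_bool big_cons big_seq1 [LHS]addrC.
by congr (_ + _); rewrite window_rconsS // setIA.
Qed.

(** Contribution of one word to the expectation of the product of the [a] times [v] at the last
    letter. Superharmonicity makes this expectation shrink by a factor [r] with each letter. *)
Let weight n k s := prb P (window_event eta n k (nth false s)) *
  \prod_(i < k.+1) a (nth false s i) * v (nth false s k).

Let weight_rcons n k s b : size s = k.+1 ->
  weight n k.+1 (rcons s b) =
  prb P (window_event eta n k (nth false s)) * \prod_(i < k.+1) a (nth false s i) *
    (Q (nth false s k) b * a b * v b).
Proof.
move=> sk; rewrite /weight etaQ window_rcons // big_ord_recr /=.
rewrite !nth_rcons sk ltnn eqxx ltnSn.
have -> : \prod_(i < k.+1) a (nth false (rcons s b) i) = \prod_(i < k.+1) a (nth false s i).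
  by apply: eq_bigr => i _; rewrite nth_rcons sk ltn_ord.
by ring.
Qed.

Let weight_sum n k : \sum_(s <- bit_words k) weight n k s <= (\sum_b a b * v b) * r ^+ k.
Proof.
elim: k => [|k IH].
  rewrite expr0 mulr1 big_bool big_cons big_seq1 [leRHS]addrC.
  apply: lerD; rewrite /weight big_ord1 /= -mulrA.
    by apply: ler_piMl; [apply: mulr_ge0; exact: ltW|exact/prb_le1/mwin].
  by apply: ler_piMl; [apply: mulr_ge0; exact: ltW|exact/prb_le1/mwin].
rewrite bit_wordsS big_allpairs_dep exprSr mulrA.
apply: le_trans (ler_wpM2r r0 IH); rewrite mulr_suml big_seq [leRHS]big_seq.
apply: ler_sum => s /size_words sk.
rewrite big_cons big_seq1 /= !weight_rcons // -mulrDr /weight -[leRHS]mulrA.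
apply: ler_wpM2l; last first.
  by rewrite [leRHS]mulrC; have := superharmonic (nth false s k); rewrite big_bool addrC.
by rewrite mulr_ge0 ?prb_ge0 // prodr_ge0 // => i _; exact: ltW.
Qed.

(** Markov's inequality, word by word: a word whose window meets [A] has a product of at least [y],
    and [v] is at least its minimum. *)
Lemma exponential_moment_bound n k A y : measurable A -> 0 < y ->
  (forall w, A w -> y <= \prod_(i < k.+1) a (eta (n + i%:Z) w)) ->
  prb P A <= (\sum_b a b * v b) * r ^+ k / (y * Num.min (v false) (v true)).
Proof.
move=> mA y0 Ay; set vm := Num.min _ _.
have vm0 : 0 < vm by rewrite lt_min !v0.
have vmP b : vm <= v b by rewrite ge_min; case: b; rewrite lexx ?orbT.
rewrite ler_pdivlMr ?mulr_gt0 //; apply: le_trans (weight_sum n k).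
rewrite (prb_words n k mA) mulr_suml; apply: ler_sum => s _.
rewrite mulrA /weight.
have [[w [Aw ww]]|none] := pselect (exists w, A w /\ window_event eta n k (nth false s) w).
  have prod_s : \prod_(i < k.+1) a (nth false s i) = \prod_(i < k.+1) a (eta (n + i%:Z) w).
    by apply: eq_bigr => i _; rewrite ww // -ltnS.
  rewrite prod_s; apply: ler_pM => //; first by rewrite mulr_ge0 ?prb_ge0 // ltW.
    exact: ltW.
  apply: ler_pM; [exact: prb_ge0|exact: ltW| |exact: Ay].
  by apply: le_prb; [exact: measurableI|exact: mwin|exact: subIsetr].
rewrite (_ : A `&` _ = set0); last first.
  by rewrite -subset0 => w [Aw ww]; apply: none; exists w.
rewrite prb0 !mul0r; apply: mulr_ge0; last exact: ltW.
by apply: mulr_ge0; [exact: prb_ge0|apply: prodr_ge0 => i _; exact: ltW].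
Qed.

End exponential_moment.

(** * Exponential bounds for the displacement of the path *)

Lemma prod_path_enc (R : realType) (theta : R) (eta : config) (n : int) (k : nat) :
  0 < theta ->
  \prod_(i < k) (if eta (n + 1 + i%:Z) then theta else theta^-1) =
  theta ^ (path_enc eta n - path_enc eta (n + k%:Z)).
Proof.
move=> th0; have th1 : theta != 0 by rewrite gt_eqF.
elim: k => [|k IH]; first by rewrite big_ord0 addr0 subrr.
rewrite big_ord_recr /= IH (path_encS eta (n + k.+1%:Z)).
rewrite (_ : n + k.+1%:Z - 1 = n + k%:Z); last by lia.
rewrite (_ : n + 1 + k%:Z = n + k.+1%:Z); last by lia.
case: (eta _) => /=.
  rewrite -[X in _ * X]expr1z -expfzDr //; congr (_ ^ _).
  by move: (path_enc _ _) (path_enc _ (_ + _)) => s t; lia.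
rewrite -[X in _ * X]/(theta ^ (- 1%:Z)) -expfzDr //; congr (_ ^ _).
by move: (path_enc _ _) (path_enc _ (_ + _)) => s t; lia.
Qed.

(* For [theta > 1] with [p1 * theta < 1 - p0] the matrix [Q] weighted by [theta] for a particle
   and [theta^-1] for a hole has spectral radius below [1]. *)
Lemma superharmonic_exists (R : realType) (p0 p1 : R) :
  0 <= p0 < 1 -> 0 <= p1 < 1 -> p0 + p1 < 1 -> exists theta r : R, exists v : bool -> R,
  [/\ 1 < theta, 0 < r < 1, forall b, 0 < v b &
      forall b, \sum_c two_state p0 p1 b c * (if c then theta else theta^-1) * v c <= r * v b].
Proof.
move=> /andP[p0_ge0 p0_lt1] /andP[p1_ge0 p1_lt1] p01.
pose th : R := 1 + (1 - p0 - p1) / 2.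
have th1 : 1 < th by rewrite /th ltrDl divr_gt0 //; lra.
have th0 : 0 < th by lra.
have gap : 0 < 1 - p0 - p1 * th.
  have -> : 1 - p0 - p1 * th = (1 - p0 - p1) * (1 - p1 / 2) by rewrite /th; field.
  by rewrite mulr_gt0 //; lra.
have e0 : 0 < th - 1 + p0 by lra.
have e1 : 0 < 1 - p1 by lra.
(* Take [v] equal to 1 at [true] and [z] at [false]. A factor below 1 in row [false] means [z > lo],
   in row [true] it means [z < hi]; the interval is nonempty precisely because [th > 1] and [gap]
   hold. *)
pose lo := p0 * th ^+ 2 / (th - 1 + p0); pose hi := th * (1 - p1 * th) / (1 - p1).
have lo0 : 0 <= lo by rewrite /lo divr_ge0 ?mulr_ge0 ?exprn_ge0 // ltW.
have lohi : lo < hi.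
  rewrite /lo /hi ltr_pdivrMr // mulrAC ltr_pdivlMr //; rewrite -subr_gt0.
  have -> : th * (1 - p1 * th) * (th - 1 + p0) - p0 * th ^+ 2 * (1 - p1) =
    th * ((th - 1) * (1 - p0 - p1 * th)) by ring.
  by rewrite !mulr_gt0 //; lra.
pose z := (lo + hi) / 2.
have zlo : lo < z by rewrite /z; lra.
have zhi : z < hi by rewrite /z; lra.
have z0 : 0 < z by lra.
pose r0 := ((1 - p0) * th^-1 * z + p0 * th) / z.
pose r1 := (1 - p1) * th^-1 * z + p1 * th.
have r0_lt1 : r0 < 1.
  rewrite /r0 ltr_pdivrMr // mul1r -(ltr_pM2r th0) mulrDl.
  have -> : (1 - p0) / th * z * th = (1 - p0) * z by field; rewrite gt_eqF.
  by move: zlo; rewrite /lo ltr_pdivrMr //; nra.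
have r1_lt1 : r1 < 1.
  rewrite /r1 -(ltr_pM2r th0) mulrDl.
  have -> : (1 - p1) / th * z * th = (1 - p1) * z by field; rewrite gt_eqF.
  by move: zhi; rewrite /hi ltr_pdivlMr //; nra.
have r0_gt0 : 0 < r0.
  rewrite divr_gt0 // ltr_wpDr ?mulr_ge0 ?(ltW th0) // !mulr_gt0 ?invr_gt0 //; lra.
exists th, (Num.max r0 r1), (fun b => if b then 1 else z); split=> //.
- by rewrite lt_max r0_gt0 /= gt_max r0_lt1.
- by case.
move=> b; rewrite big_bool /two_state /=; case: b; rewrite !mulr1.
  by rewrite [leLHS]addrC le_max lexx orbT.
apply: (@le_trans _ _ (r0 * z)); last by rewrite ler_pM2r // le_max lexx.
by rewrite /r0 divfK ?gt_eqF // [leLHS]addrC.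
Qed.

(** If the path rises by at most [j / m] over [j] sites, the weight is at least [sigma ^+ j], and
    the moment bound becomes the summable [(r / sigma) ^+ j]. *)
Lemma slow_root (R : realType) (theta r : R) : 1 < theta -> 0 < r < 1 ->
  exists (sigma : R) (m : nat), [/\ r < sigma, sigma < 1, (0 < m)%N &
    forall (s : int) (j : nat), m%:Z * s <= j%:Z -> sigma ^+ j <= theta ^ (- s)].
Proof.
move=> th1 /andP[r0 r1]; have th0 : 0 < theta by lra.
pose sigma := (r + 1) / 2.
have s0 : 0 < sigma by rewrite /sigma; lra.
have s1 : sigma < 1 by rewrite /sigma; lra.
have [m sm] : exists m, sigma ^+ m <= theta^-1.
  apply: contrapT => nm; suff : theta^-1 <= 0 by rewrite leNgt invr_gt0 th0.
  apply: (@ge0_geometric_le0 _ 1 sigma); first by rewrite (ltW s0).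
  by move=> n; rewrite mul1r leNgt; apply/negP => /ltW sn; apply: nm; exists n.
exists sigma, m; split=> //; first by rewrite /sigma; lra.
  by case: m sm => // ; rewrite expr0 leNgt invf_lt1 // th1.
move=> s j; have [sneg _|spos ms] := lerP s 0.
  apply: (@le_trans _ _ 1); first by apply: exprn_ile1; exact: ltW.
  have -> : - s = `|s|%N%:Z by lia.
  by rewrite -exprnP exprn_ege1 // ltW.
have sE : s = `|s|%N%:Z by lia.
rewrite sE -exprnN -exprVn; apply: (@le_trans _ _ ((sigma ^+ m) ^+ `|s|%N)); last first.
  by apply: lerXn2r => //; rewrite nnegrE ltW // ?exprn_gt0 // invr_gt0.
rewrite -exprM; apply: ler_wiXn2l; [exact: ltW|exact: ltW|].
by move: ms; rewrite [in X in X -> _]sE -PoszM lez_nat.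
Qed.

(** The counterpart for a large fall: descending by [j / m] costs a factor [sigma ^+ j], whatever
    the number of sites. *)
Lemma fast_root (R : realType) (theta : R) (m : nat) : 1 < theta -> (0 < m)%N ->
  exists sigma : R, 0 < sigma < 1 /\
    forall (s : int) (j : nat), m%:Z * s <= - j%:Z -> sigma ^- j <= theta ^ (- s).
Proof.
move=> th1 m0; have th0 : 0 < theta by lra.
(* Bernoulli's inequality gives [sigma ^+ m >= theta^-1] with no root extracted. *)
pose sigma := 1 - (1 - theta^-1) / m%:R.
have ti1 : theta^-1 < 1 by rewrite invf_lt1.
have ti0 : 0 < theta^-1 by rewrite invr_gt0.
have m1 : 1 <= m%:R :> R by rewrite ler1n.
have mR : 0 < m%:R :> R by rewrite ltr0n.
have x0 : 0 < (1 - theta^-1) / m%:R by rewrite divr_gt0 // subr_gt0.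
have x1 : (1 - theta^-1) / m%:R < 1 by rewrite ltr_pdivrMr // mul1r; lra.
have s0 : 0 < sigma by rewrite /sigma subr_gt0.
have s1 : sigma < 1 by rewrite /sigma gtrBl.
have bernoulli k : 1 - k%:R * ((1 - theta^-1) / m%:R) <= sigma ^+ k.
  elim: k => [|k IH]; first by rewrite mul0r subr0 expr0.
  rewrite exprS; apply: (@le_trans _ _ (sigma * (1 - k%:R * ((1 - theta^-1) / m%:R)))).
    rewrite /sigma -natr1; set x := _ / _; have : 0 <= k%:R * x ^+ 2 by rewrite mulr_ge0 // sqr_ge0.
    by lra.
  by rewrite ler_pM2l.
have sm : theta^-1 <= sigma ^+ m.
  by have := bernoulli m; rewrite mulrC divfK ?gt_eqF // opprB addrC subrK.
exists sigma; split; first by rewrite s0.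
move=> s j ms.
have -> : - s = `|s|%N%:Z by nia.
rewrite -exprnP -[theta]invrK exprVn lef_pV2 ?posrE ?exprn_gt0 //.
apply: (@le_trans _ _ ((sigma ^+ m) ^+ `|s|%N)).
  by apply: lerXn2r => //; rewrite nnegrE ltW // exprn_gt0.
rewrite -exprM; apply: ler_wiXn2l; [exact: ltW|exact: ltW|].
by nia.
Qed.

Section drift.
Context (R : realType) (p0 p1 : R).
Hypotheses (p0_itv : 0 <= p0 < 1) (p1_itv : 0 <= p1 < 1) (p01 : p0 + p1 < 1).
Context d (Omega : measurableType d) (P : probability Omega R).
Context (eta : int -> Omega -> bool).
Hypothesis meta : forall n, dmeas (eta n).
Hypothesis etaQ : forall n k x, prb P (window_event eta n k.+1 x) =
                   prb P (window_event eta n k x) * two_state p0 p1 (x k) (x k.+1).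

Let S w := path_enc (fun n => eta n w).

Lemma drift_bound : exists theta C r : R, [/\ 1 < theta, 0 < r < 1, 0 <= C &
  forall (n : int) (k : nat) (A : set Omega) (y : R), measurable A -> 0 < y ->
    (forall w, A w -> y <= theta ^ (S w n - S w (n + k%:Z))) ->
    prb P A <= C * r ^+ k / y].
Proof.
have [th [r [v [th1 r01 v0 sup]]]] := superharmonic_exists p0_itv p1_itv p01.
have th0 : 0 < th by lra.
have [r0 r1] := andP r01.
pose a (b : bool) := if b then th else th^-1.
have a0 b : 0 < a b by case: b; rewrite /a ?invr_gt0.
(* A window of [k + 1] sites carries only [r ^+ k]; dividing by [r] restores one power per site. *)
pose D := (\sum_b a b * v b) / (Num.min (v false) (v true) * r).
have vm0 : 0 < Num.min (v false) (v true) by rewrite lt_min !v0.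
have D0 : 0 <= D.
  rewrite divr_ge0 ?mulr_ge0 ?(ltW r0) ?(ltW vm0) // sumr_ge0 // => b _.
  by rewrite mulr_ge0 // ltW.
(* The 1 covers [k = 0], where a nonempty [A] forces [y <= 1]. *)
exists th, (D + 1), r; split=> //; first by rewrite addr_ge0.
move=> n [|k] A y mA y0 Ay.
  rewrite expr0 mulr1 ler_pdivlMr //; have [[w Aw]|A0] := pselect (exists w, A w).
    have := Ay w Aw; rewrite addr0 subrr expr0z => y1.
    rewrite (@le_trans _ _ 1) ?lerDr // -[leRHS]mulr1.
    by apply: ler_pM => //; [exact: prb_ge0|exact: ltW|exact: prb_le1].
  rewrite (_ : A = set0); last by rewrite -subset0 => w Aw; apply: A0; exists w.
  by rewrite prb0 mul0r addr_ge0.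
have bound := exponential_moment_bound meta etaQ (ltW r0) a0 v0 sup (n := n + 1) (k := k) mA y0.
apply: (@le_trans _ _ (D * r ^+ k.+1 / y)); last first.
  by rewrite ler_pM2r ?invr_gt0 // ler_pM2r ?exprn_gt0 // lerDl.
rewrite (_ : D * _ / _ = (\sum_b a b * v b) * r ^+ k /
    (y * Num.min (v false) (v true))); last first.
  rewrite /D exprS; field.
  by rewrite !gt_eqF.
by apply: bound => w /Ay; rewrite /S -(prod_path_enc _ _ _ th0).
Qed.

End drift.

(** * Configurations of a two-state Markov chain *)

Lemma path_enc_bound eta n : `|path_enc eta n| <= `|n|.
Proof.
have up : {homo (fun n => n - path_enc eta n) : m n / m <= n}.
  by apply: int_homo => k; rewrite (path_encS eta k); case: (eta k);
    move: (path_enc _ _) => s /=; lia.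
have down : {homo (fun n => n + path_enc eta n) : m n / m <= n}.
  by apply: int_homo => k; rewrite (path_encS eta k); case: (eta k);
    move: (path_enc _ _) => s /=; lia.
have [n0|n0] := lerP 0 n.
  by have := up _ _ n0; have := down _ _ n0; rewrite path_enc0; move: (path_enc _ _) => s; lia.
have := up _ _ (ltW n0); have := down _ _ (ltW n0).
by rewrite path_enc0; move: (path_enc _ _) => s; lia.
Qed.

Lemma past_max_exists eta (N : nat) :
  (forall j : nat, (N <= j)%N -> path_enc eta (- j%:Z) <= 0) ->
  forall n : int, exists m, m <= n /\ forall k, k <= n -> path_enc eta k <= path_enc eta m.
Proof.
move=> neg n; set S := path_enc eta.
(* The heights above [S n] that the past reaches form a nonempty bounded set of naturals; its
   largest element is the maximum. *)
pose above (i : nat) := `[< exists k, k <= n /\ S k = S n + i%:Z >].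
have above0 : exists i, above i by exists 0%N; apply/asboolP; exists n; rewrite addr0.
have above_bound i : above i -> (i <= `|S n| + `|n| + N)%N.
  move=> /asboolP[k [kn Sk]]; have : S k <= `|n| + N%:Z.
    have [kN|Nk] := lerP k (- N%:Z).
      have kE : k = - (absz k)%:Z by lia.
      have := neg (absz k); rewrite -kE => /(_ ltac:(lia)).
      by rewrite -/(S k); move: (S k) => s; lia.
    by have := path_enc_bound eta k; rewrite -/(S k); move: (S k) => s; lia.
  by rewrite Sk; move: (S n) => s; lia.
have [i /asboolP[m [mn Sm]] imax] := ex_maxnP above0 above_bound.
exists m; split=> // k kn; have [|lt] := lerP (S k) (S n).
  by move: Sm; rewrite -/(S k) -/(S m); move: (S k) (S m) (S n) => a b c; lia.
have /imax : above (absz (S k - S n)).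
  by apply/asboolP; exists k; split=> //; move: lt; move: (S k) (S n) => a b; lia.
by move: Sm lt; rewrite -/(S k) -/(S m); move: (S k) (S m) (S n) => a b c; lia.
Qed.

(* Where the past maximum is infinite, [past_max] returns [0]; taking it of differences makes
   [carrier] commute with shifts even there. *)
Definition carrier (eta : zseq bool) (n : int) : nat :=
  absz (past_max (fun k => path_enc eta k - path_enc eta n) n).

Lemma carrier_attained (eta : config) (m n : int) :
  m <= n -> (forall k, k <= n -> path_enc eta k <= path_enc eta m) ->
  (carrier eta n)%:Z = path_enc eta m - path_enc eta n.
Proof.
move=> mn max; rewrite /carrier (@past_max_attained _ m) // => [|k kn].
  by rewrite gez0_abs // subr_ge0; exact: max.
by rewrite lerD2r; exact: max.
Qed.

Lemma carrier_ruleP (eta : config) :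
  (forall n : int, exists m, m <= n /\ forall k, k <= n -> path_enc eta k <= path_enc eta m) ->
  carrier_rule eta (carrier eta) /\ forall n : int, exists m, m <= n /\ carrier eta m = 0%N.
Proof.
move=> attained; split=> [n|n]; last first.
  have [m [mn max]] := attained n; exists m; split=> //.
  have := @carrier_attained eta m m (lexx _).
  by rewrite subrr => E; apply/eqP; rewrite -eqz_nat E // => k km; apply: max; exact: le_trans mn.
have [m [mn max]] := attained (n - 1); have Vn1 := carrier_attained mn max.
have ge0 := max _ (lexx _).
(* Either [n] sets a new record and the step is flat, or the old maximum at [m] persists. *)
have [eq|lt] := eqVneq (path_enc eta m) (path_enc eta n - 1).
  have etan : eta n = false.
    by have := path_encS eta n; case: (eta n) => //; move: ge0 eq;
      move: (path_enc _ _) (path_enc _ _) (path_enc _ _) => a b c /=; lia.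
  have : (carrier eta n)%:Z = path_enc eta n - path_enc eta n.
    apply: carrier_attained => // k; rewrite le_eqVlt => /predU1P[->//|kn].
    have : path_enc eta k <= path_enc eta m by apply: max; lia.
    by rewrite eq; move: (path_enc _ _) (path_enc _ _) => a b; lia.
  have := path_encS eta n; rewrite etan /=; move: ge0 eq Vn1.
  move: (path_enc _ _) (path_enc _ _) (path_enc _ _) (carrier _ _) (carrier _ _) => a b c u v; lia.
have : (carrier eta n)%:Z = path_enc eta m - path_enc eta n.
  apply: carrier_attained => [|k]; first by lia.
  rewrite le_eqVlt => /predU1P[->|kn]; last by apply: max; lia.
  have := path_encS eta n; move: ge0 lt; case: (eta n) => /=;
    by move: (path_enc _ _) (path_enc _ _) (path_enc _ _) => a b c; lia.
have := path_encS eta n; move: ge0 lt Vn1; case: (eta n) => /=;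
  by move: (path_enc _ _) (path_enc _ _) (path_enc _ _) (carrier _ _) (carrier _ _)
    => a b c u v; lia.
Qed.

Lemma path_enc_shift eta (k n : int) :
  path_enc (fun i => eta (i + k)) n = path_enc eta (n + k) - path_enc eta k.
Proof.
pose D n := path_enc (fun i => eta (i + k)) n - path_enc eta (n + k).
have DS n' : D n' = D (n' - 1).
  rewrite /D path_encS (path_encS eta (n' + k)) (_ : n' + k - 1 = n' - 1 + k); last by lia.
  by rewrite opprD addrACA subrr addr0.
have up : {homo D : m n / m <= n} by apply: int_homo => i; rewrite -DS.
have down : {homo (fun n => - D n) : m n / m <= n} by apply: int_homo => i; rewrite -DS.
have D0 : D 0 = - path_enc eta k by rewrite /D path_enc0 sub0r add0r.
suff : D n = D 0 by rewrite D0 /D; move: (path_enc _ _) (path_enc _ _) (path_enc _ _) => a b c; lia.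
by have [n0|n0] := lerP 0 n; [have := up _ _ n0; have := down _ _ n0
  |have := up _ _ (ltW n0); have := down _ _ (ltW n0)]; move: (D n) (D 0) => a b; lia.
Qed.

Lemma carrier_shift (eta : config) (k n : int) :
  carrier (fun i => eta (i + k)) n = carrier eta (n + k).
Proof.
rewrite /carrier /past_max; congr (absz (supremum 0 _)).
apply/seteqP; split=> [_ [m /= mn <-]|_ [m /= mn <-]].
  exists (m + k); first by rewrite /= lerD2r.
  by rewrite !path_enc_shift; move: (path_enc _ _) (path_enc _ _) (path_enc _ _) => a b c; lia.
exists (m - k); first by rewrite /= lerBlDr.
by rewrite !path_enc_shift subrK; move: (path_enc _ _) (path_enc _ _) (path_enc _ _) => a b c; lia.
Qed.

(** Only differences of the path up to [n] enter, so events of the carrier are events of the past,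
    as [past_markov] requires. *)
Lemma carrier_past (eta eta' : config) (N n : int) : n <= N ->
  (forall i, i <= N -> eta i = eta' i) -> carrier eta n = carrier eta' n.
Proof.
move=> nN agree; rewrite /carrier /past_max; congr (absz (supremum 0 _)).
have diff m : m <= n -> path_enc eta m - path_enc eta n = path_enc eta' m - path_enc eta' n.
  apply: (int_descent (Q := fun m => path_enc eta m - path_enc eta n =
    path_enc eta' m - path_enc eta' n)); first by rewrite !subrr.
  move=> k kn; rewrite (path_encS eta k) (path_encS eta' k) agree; last exact: le_trans nN.
  by move: (path_enc _ _) (path_enc _ _) (path_enc _ _) (path_enc _ _) => a b c e; lia.
by apply/seteqP; split=> _ [m /= mn <-]; exists m => //; rewrite diff.
Qed.

(** One half of [j] pays for [V] and the other half for the successor: each of [m * l.+1 * V] and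
    [m * l.+1] is at most [j / 2]. *)
Lemma depth_vs_height (m l V j : nat) (s : int) : (0 < m)%N ->
  j%:Z < m%:Z * s -> (m * l.+1 * 2).+1%:Z * V%:Z < j%:Z -> (m * l.+1 * 2 <= j)%N ->
  l%:Z * V.+1%:Z <= s.
Proof.
move=> m0 js Vj lj.
have mlV : (m * l.+1 * V.+1 < j)%N.
  move: Vj lj; rewrite -PoszM ltz_nat; move: (m * l.+1)%N => t; nia.
have : m%:Z * (l%:Z * V.+1%:Z) < m%:Z * s.
  apply: le_lt_trans js; rewrite -!PoszM lez_nat mulnA.
  by apply: leq_trans (ltnW mlV); rewrite leq_mul2r leq_mul2l leqnSn !orbT.
by rewrite ltr_pM2l ?ltz_nat // => /ltW.
Qed.

(** * Growth of the path and depth below its maximum *)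

Section growth.
Context (R : realType) (p0 p1 : R).
Hypotheses (p0_itv : 0 <= p0 < 1) (p1_itv : 0 <= p1 < 1) (p01 : p0 + p1 < 1).
Context d (Omega : measurableType d) (P : probability Omega R).
Context (eta : int -> Omega -> bool).
Hypothesis meta : forall n, dmeas (eta n).
Hypothesis etaQ : forall n k x, prb P (window_event eta n k.+1 x) =
                   prb P (window_event eta n k x) * two_state p0 p1 (x k) (x k.+1).

Let S w := path_enc (fun n => eta n w).

Let mS n : dmeas (fun w => S w n).
Proof. exact: dmeas_path_enc. Qed.

Let mSS n n' (B : set (int * int)) : measurable [set w | B (S w n, S w n')].
Proof. exact: (dmeas_pair (mS n) (mS n') B). Qed.

(** The base point moves with [j]: 0 serves the future, [- j] the past, with the same [m]. *)
Lemma linear_growth : exists m : nat, (0 < m)%N /\ forall c : nat -> int,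
  {ae P, forall w, exists N, forall j, (N <= j)%N ->
    j%:Z < m%:Z * (S w (c j + j%:Z) - S w (c j))}.
Proof.
have [theta [C [r [th1 r01 C0 bound]]]] := drift_bound p0_itv p1_itv p01 meta etaQ.
have [sigma [m [rs s1 m0 rootP]]] := slow_root th1 r01.
have s0 : 0 < sigma by move: r01 => /andP[r0 _]; exact: lt_trans rs.
exists m; split=> // c.
pose B j := [set w | m%:Z * (S w (c j + j%:Z) - S w (c j)) <= j%:Z].
have mB j : measurable (B j) by exact: (mSS _ _ [set s | m%:Z * (s.1 - s.2) <= j%:Z]).
have BP j : prb P (B j) <= C * (r / sigma) ^+ j.
  rewrite exprMn exprVn mulrA; apply: (bound (c j)) => //; first by rewrite exprn_gt0.
  by move=> w /rootP; rewrite opprB.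
have rs01 : 0 <= r / sigma < 1.
  by move: r01 => /andP[r0 r1]; rewrite divr_ge0 ?ltW //= ltr_pdivrMr // mul1r.
apply: filterS (geometric_borel_cantelli rs01 mB BP) => w [N NB]; exists N => j /NB nB.
by rewrite ltNge; apply/negP.
Qed.

(** At each [j] the bounds for all [k] are summed first, so that the whole past of [c j] is
    controlled; Borel-Cantelli then applies along [j]. *)
Lemma sublinear_depth (m : nat) (c : nat -> int) : (0 < m)%N ->
  {ae P, forall w, exists N, forall j, (N <= j)%N -> forall k : nat,
    - j%:Z < m%:Z * (S w (c j) - S w (c j - k%:Z))}.
Proof.
move=> m0.
have [theta [C [r [th1 r01 C0 bound]]]] := drift_bound p0_itv p1_itv p01 meta etaQ.
have [sigma [s01 rootP]] := fast_root th1 m0; have [s0 s1] := andP s01.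
have r01' : 0 <= r < 1 by move: r01 => /andP[/ltW -> ->].
pose B j k := [set w | m%:Z * (S w (c j) - S w (c j - k%:Z)) <= - j%:Z].
have mB j k : measurable (B j k) by exact: (mSS _ _ [set s | m%:Z * (s.1 - s.2) <= - j%:Z]).
have BP j k : prb P (B j k) <= C * sigma ^+ j * r ^+ k.
  rewrite mulrAC -[sigma ^+ j]invrK; apply: (bound (c j - k%:Z)) => //.
    by rewrite invr_gt0 exprn_gt0.
  by move=> w /rootP; rewrite opprB subrK.
have BU j : prb P (\bigcup_k B j k) <= C / (1 - r) * sigma ^+ j.
  by rewrite mulrAC; exact: prb_geometric_union.
have mBU j : measurable (\bigcup_k B j k) by exact: bigcupT_measurable.
have s01' : 0 <= sigma < 1 by rewrite (ltW s0).
apply: filterS (geometric_borel_cantelli s01' mBU BU) => w [N NB]; exists N => j /NB nB k.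
by rewrite ltNge; apply/negP => le; apply: nB; exists k.
Qed.

Lemma growth_attained : {ae P, forall w, forall n : int,
  exists m, m <= n /\ forall k, k <= n -> S w k <= S w m}.
Proof.
have [m [m0 growth]] := linear_growth.
apply: filterS (growth (fun j => - j%:Z)) => w [N HN].
apply: (@past_max_exists _ N) => j Nj; have := HN j Nj.
rewrite addNr /S path_enc0 sub0r; move: (path_enc _ _) => s; nia.
Qed.

Lemma growth_subcritical :
  {ae P, forall w, subcritical R (path_enc (fun n => eta n w))}.
Proof.
have [m [m0 growth]] := linear_growth.
have depth : {ae P, forall w, forall l : nat, exists N, forall j, (N <= j)%N -> forall k : nat,
    - j%:Z < l.+1%:Z * (S w j%:Z - S w (j%:Z - k%:Z)) /\
    - j%:Z < l.+1%:Z * (S w (- j%:Z) - S w (- j%:Z - k%:Z))}.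
  apply: ae_forallC => l.
  apply: filterS2 (@sublinear_depth l.+1 Posz isT) (@sublinear_depth l.+1 (fun j => - j%:Z) isT).
  move=> w [N1 H1] [N2 H2]; exists (maxn N1 N2) => j; rewrite geq_max => /andP[j1 j2] k.
  by split; [exact: H1|exact: H2].
have growth2 : {ae P, forall w, (exists N, forall j, (N <= j)%N -> j%:Z < m%:Z * S w j%:Z) /\
    (exists N, forall j, (N <= j)%N -> j%:Z < m%:Z * - S w (- j%:Z))}.
  apply: filterS2 (growth (fun j => 0)) (growth (fun j => - j%:Z)) => w [N1 H1] [N2 H2].
  split; [exists N1 => j /H1|exists N2 => j /H2]; rewrite /S.
    by rewrite add0r path_enc0 subr0.
  by rewrite addNr path_enc0 sub0r.
apply: filterS3 growth_attained depth growth2 => w attained dep [[N1 H1] [N2 H2]].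
have [rule _] := carrier_ruleP attained.
apply: (@subcritical_carrier R _ _ rule) => l.
have [N HN] := dep (m * l.+1 * 2)%N.
exists (N + N1 + N2 + m * l.+1 * 2)%N => j jN.
have small (n : int) : (forall k : nat,
      - j%:Z < (m * l.+1 * 2).+1%:Z * (S w n - S w (n - k%:Z))) ->
    (m * l.+1 * 2).+1%:Z * (carrier (fun n => eta n w) n)%:Z < j%:Z.
  have [m1 [m1n max1]] := attained n => /(_ (absz (n - m1))).
  rewrite (carrier_attained m1n max1) (_ : n - _ = m1); last by lia.
  by rewrite ltrNl -mulrN opprB.
split.
  apply: (le_trans (depth_vs_height m0 (H1 j _) (small _ _) _)); last exact: ler_norm.
  - by lia.
  - by move=> k; have [] := HN j _ k; first lia.
  - by lia.
apply: (le_trans (depth_vs_height m0 (H2 j _) (small _ _) _)); last by rewrite -normrN ler_norm.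
- by lia.
- by move=> k; have [] := HN j _ k; first lia.
- by lia.
Qed.

End growth.

(** * Reversal of the carrier of a two-state chain *)

Section two_state_chain.
Context (R : realType) (p0 p1 : R).
Hypotheses (p0_itv : 0 <= p0 < 1) (p1_itv : 0 <= p1 < 1) (p01 : p0 + p1 < 1).
Context d (Omega : measurableType d) (P : probability Omega R).
Context (eta : int -> {RV P >-> bool}).
Let Q := two_state p0 p1.
Hypothesis markE : markov_chain Q eta.
Hypothesis statE : stationary eta.

Let V (n : int) (w : Omega) : nat := carrier (process eta w) n.

Let meta n : dmeas (eta n). Proof. exact: (dmeas_RV _ discrete_bool). Qed.

Let etaQ := markov_prb discrete_bool markE.

Let Q_ge0 b c : 0 <= Q b c.
Proof.
by move: p0_itv p1_itv => /andP[? ?] /andP[? ?]; rewrite /Q /two_state; case: b c => -[]; lra.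
Qed.

Let mcoordb i : dmeas (coord i : zseq bool -> _).
Proof. exact: (discrete_dmeas discrete_bool (measurable_coord i)). Qed.

Let mcarrier n : dmeas (fun z : zseq bool => carrier z n).
Proof.
have mS k := dmeas_path_enc k mcoordb.
apply: (@dmeas_comp _ (zseq bool) _ _ absz
  (fun z => past_max (fun k => path_enc z k - path_enc z n) n)).
apply: (@dmeas_past_max _ (zseq bool) (fun k z => path_enc z k - path_enc z n)) => k.
exact: (dmeas2 (fun x y => x - y) (mS k) (mS n)).
Qed.

Let mV n : dmeas (V n).
Proof.
apply: dmeas_eq => v; rewrite -[X in measurable X]setTI.
exact: (measurable_process meta measurableT (mcarrier n [set v])).
Qed.

Let rule : {ae P, forall w, carrier_rule (fun n => eta n w) (fun n => V n w) /\
  forall n : int, exists m, m <= n /\ V m w = 0%N}.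
Proof.
by apply: filterS (growth_attained p0_itv p1_itv p01 meta etaQ) => w /carrier_ruleP.
Qed.

Let V2_stat n (B : set (nat * nat)) :
  prb P [set w | B (V (n - 1) w, V n w)] = prb P [set w | B (V (0 - 1) w, V 0 w)].
Proof.
have mB : measurable [set z : zseq bool | B (carrier z (0 - 1), carrier z 0)].
  exact: (dmeas_pair (mcarrier (0 - 1)) (mcarrier 0) B).
rewrite -(stationary_prb n statE mB); congr prb; apply/seteqP.
split=> w /=; rewrite /process /V (carrier_shift (process eta w)) (carrier_shift (process eta w));
  by rewrite add0r (_ : 0 - 1 + n = n - 1) // addrC add0r.
Qed.

Let pi (e : nat * nat) : R := prb P [set w | (V (0 - 1) w, V 0 w) = e].

Let piE n e : prb P [set w | (V (n - 1) w, V n w) = e] = pi e.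
Proof. exact: (V2_stat n [set e]). Qed.

Let m2 n n' (B : set (nat * nat)) : measurable [set w | B (V n w, V n' w)].
Proof. exact: (dmeas_pair (mV n) (mV n') B). Qed.

Let valid (e : nat * nat) : bool := (e.2 == e.1.+1) || (e.2 == e.1.-1).

Let up (e : nat * nat) : bool := e.2 == e.1.+1.

Let ae_edge n : {ae P, forall w, valid (V (n - 1) w, V n w) /\
  eta n w = up (V (n - 1) w, V n w)}.
Proof.
apply: filterS rule => w [/(_ n) + _]; rewrite /valid /up /= => ->.
by move: (V (n - 1) w) => v; case: (eta n w); rewrite ?eqxx ?orbT //; split=> //; lia.
Qed.

Let pi_invalid e : ~~ valid e -> pi e = 0.
Proof.
move=> ne; apply: prb0_ae; first exact: (m2 (0 - 1) 0 [set e]).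
by apply: filterS (ae_edge 0) => w [ve _] we; move: ne; rewrite -we ve.
Qed.

Let pi_swap e : pi (e.2, e.1) = pi e.
Proof.
have flux1 k : pi (k, k.+1) = pi (k.+1, k).
  have E a b : pi (a, b) = prb P [set w | V (0 - 1) w = a /\ V 0 w = b].
    by congr prb; apply/seteqP; split=> w /= [-> ->].
  rewrite !E; apply: flux => //.
    have := V2_stat (0 - 1) [set v | (v.2 <= k)%N]; rewrite /= => ->.
    by [].
  by apply: filterS (ae_edge 0) => w [/orP[] /eqP /= -> _]; move: (V _ w) => v; lia.
case: e => a b /=; have [ba|nba] := eqVneq b a.+1; first by rewrite ba flux1.
have [ab|nab] := eqVneq a b.+1; first by rewrite ab flux1.
have [->//|neq] := eqVneq a b.
by rewrite !pi_invalid // /valid /=; lia.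
Qed.

Let past n (B : set (zseq bool)) b c : measurable B ->
  (forall z z' : zseq bool, (forall i : int, i <= n -> z i = z' i) -> B z -> B z') ->
  prb P [set w | B (process eta w) /\ (eta n w = b /\ eta (n + 1) w = c)] =
  prb P [set w | B (process eta w) /\ eta n w = b] * Q b c.
Proof. by move=> mB pastB; rewrite (past_markov discrete_bool meta Q_ge0 etaQ mB pastB). Qed.

(** A particle follows a visit to [k], which was entered from [k - 1] by a particle, or by a hole
    from [k + 1] or through the flat step at 0. *)
Let pi_up k : pi (k, k.+1) =
  (if k is k'.+1 then pi (k', k) else 0) * p1 +
  (pi (k.+1, k) + (if k is 0%N then pi (0%N, 0%N) else 0)) * p0.
Proof.
pose B : set (zseq bool) := [set z | carrier z 0 = k].
have mB : measurable B by exact: (mcarrier 0 [set k]).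
have pastB (z z' : zseq bool) : (forall i : int, i <= 0 -> z i = z' i) -> B z -> B z'.
  by move=> zz'; rewrite /B /= (carrier_past (lexx 0) zz').
have mBw : measurable [set w | B (process eta w)] by exact: (mV 0 [set k]).
have mBb b : measurable [set w | B (process eta w) /\ eta 0 w = b].
  by apply: measurableI => //; exact: (meta 0 [set b]).
have mBbc b c : measurable [set w | B (process eta w) /\ (eta 0 w = b /\ eta (0 + 1) w = c)].
  apply: measurableI => //.
  by apply: measurableI; [exact: (meta 0 [set b])|exact: (meta (0 + 1) [set c])].
have -> : pi (k, k.+1) =
    prb P [set w | B (process eta w) /\ eta 0 w = true] * Q true true +
    prb P [set w | B (process eta w) /\ eta 0 w = false] * Q false true.
  have mBt : measurable [set w | B (process eta w) /\ eta (0 + 1) w = true].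
    by apply: measurableI => //; exact: (meta (0 + 1) [set true]).
  rewrite -(piE (0 + 1)) addrK.
  rewrite (@prb_ae _ _ _ P _ [set w | B (process eta w) /\ eta (0 + 1) w = true]) //.
  - rewrite (@prb_split _ _ _ P _ [set w | eta 0 w = true]) //; last exact: (meta 0 [set true]).
    rewrite -!past //; congr (_ + _); congr prb; apply/seteqP; split=> w /=; try tauto.
      by case: (eta 0 w); tauto.
    by case: (eta 0 w) => -[? []].
  - exact: (m2 0 (0 + 1) [set (k, k.+1)]).
  apply: filterS (ae_edge (0 + 1)) => w; rewrite addrK /up /valid /= => -[ve ->].
  rewrite /B /= -/(V 0 w); move: (V _ w) (V 0 w) ve => v1 v0 _.
  by split=> [[-> ->]|[-> E]]; [rewrite eqxx|rewrite (eqP E)].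
rewrite /Q /two_state; congr (_ * _ + _ * _).
  rewrite (@prb_ae _ _ _ P _ [set w | V 0 w = k /\ up (V (0 - 1) w, V 0 w)]) //.
  - case: k @B mB pastB mBw mBb mBbc => [|k'] *.
      rewrite -(prb0 P); congr prb; rewrite -subset0 => w /= [-> /eqP //].
    congr prb; apply/seteqP; split=> w; rewrite /up /=; move: (V (0 - 1) w) (V 0 w) => a b.
      by case=> -> /eqP [->].
    by case=> -> ->; rewrite eqxx.
  - exact: (m2 (0 - 1) 0 [set e | e.2 = k /\ up e]).
  by apply: filterS (ae_edge 0) => w [_ E] /=; rewrite E; split.
have mC : measurable [set w | V 0 w = k /\ ~~ up (V (0 - 1) w, V 0 w)].
  exact: (m2 (0 - 1) 0 [set e | e.2 = k /\ ~~ up e]).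
rewrite (@prb_ae _ _ _ P _ [set w | V 0 w = k /\ ~~ up (V (0 - 1) w, V 0 w)]) //; last first.
  apply: filterS (ae_edge 0) => w [_ E] /=; rewrite E.
  by split=> -[Vk uf]; split=> //; [rewrite uf|exact: negbTE].
rewrite (prb_split P mC (m2 (0 - 1) 0 [set (k.+1, k)])); congr (_ + _).
  congr prb; apply/seteqP; split=> w /=; first by case.
  by rewrite /up /=; move: (V (0 - 1) w) (V 0 w) => a b [-> ->]; do !split; lia.
have mD : measurable ([set w | V 0 w = k /\ ~~ up (V (0 - 1) w, V 0 w)] `&`
    ~` [set w | (V (0 - 1) w, V 0 w) = (k.+1, k)]).
  by apply: measurableI => //; apply: measurableC; exact: (m2 (0 - 1) 0 [set (k.+1, k)]).
case: k @B mB pastB mBw mBb mBbc mC mD => [|k'] B mB pastB mBw mBb mBbc mC mD.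
  apply: prb_ae => //; first exact: (m2 (0 - 1) 0 [set (0%N, 0%N)]).
  apply: filterS (ae_edge 0) => w; rewrite /valid /up /=.
  move: (V (0 - 1) w) (V 0 w) => a b [ve _]; split=> [[[b0 nup] ne]|[-> ->]].
    congr (_, _) => //; move: ve; rewrite b0 /= => /eqP a1.
    by case: a a1 ne nup => [|[|a]] //=; rewrite b0.
  by split.
apply: prb0_ae => //; apply: filterS (ae_edge 0) => w; rewrite /valid /up /=.
move: (V (0 - 1) w) (V 0 w) => a b [ve _] [[bk nup] ne].
by apply: ne; congr (_, _) => //; move: ve; rewrite (negbTE nup) => /eqP; lia.
Qed.

(** Once [pi] is symmetric, [pi_up] is an equation in [pi (k.+1, k.+2)]; solved, it balances two
    up-steps in a row against two down-steps. *)
Let edge_balance k : pi (k, k.+1) * p1 = pi (k.+1, k.+2) * (1 - p0).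
Proof.
have := pi_up k.+1; have /= -> := pi_swap (k.+1, k.+2).
by rewrite addr0 => E; rewrite mulrBr mulr1 {1}E addrK.
Qed.

Let flat_balance : pi (0%N, 1%N) * (1 - p0) = pi (0%N, 0%N) * p0.
Proof.
have := pi_up 0; have /= -> := pi_swap (0%N, 1%N).
by rewrite mul0r add0r mulrDl => E; rewrite mulrBr mulr1 {1}E addrC addKr.
Qed.

(* The carrier [V] alone is not a Markov chain, since the law of the next step depends on the
   last one; the chain of its edges is Markov, and reversible up to swapping the end points. *)
Let edge n w : nat * nat := (V (n - 1) w, V n w).

Let Qedge (e e' : nat * nat) : R :=
  if (e'.1 == e.2) && valid e' then Q (up e) (up e') else 0.

Let medge n : dmeas (edge n).
Proof. exact: (dmeas_pair (mV (n - 1)) (mV n)). Qed.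

Let edge_markov n k x : prb P (window_event edge n k.+1 x) =
  prb P (window_event edge n k x) * Qedge (x k) (x k.+1).
Proof.
have dN := discrete_prod discrete_nat discrete_nat.
have mw i y : measurable (window_event edge n i y) by exact: measurable_window.
set N := n + k%:Z.
have NE : n + k.+1%:Z = N + 1 by rewrite /N; lia.
rewrite /Qedge; case: ifPn => [/andP[/eqP adj vx]|nadj]; last first.
  rewrite mulr0; apply: prb0_ae => //; apply: filterS (ae_edge (N + 1)) => w [ve _] ww.
  have E1 : edge (N + 1) w = x k.+1 by rewrite -NE; exact: ww.
  have E0 : edge N w = x k by apply: ww.
  move: nadj; rewrite -E1 -E0 /edge /= addrK eqxx /=.
  by move: ve; rewrite addrK => ->.
(* The window of edges is an event of the past of [eta] at [N], and its last edge almost surely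
   fixes [eta N]. *)
pose B : set (zseq bool) := [set z | forall i : nat, (i <= k)%N ->
  (carrier z (n + i%:Z - 1), carrier z (n + i%:Z)) = x i].
have mB : measurable B.
  apply: measurable_forallC => i; apply: measurable_imply => _.
  exact: (dmeas_pair (mcarrier _) (mcarrier _) [set x i]).
have pastB (z z' : zseq bool) : (forall i : int, i <= N -> z i = z' i) -> B z -> B z'.
  move=> zz' Bz i ik; rewrite -(Bz i ik).
  by congr (_, _); apply/esym/(@carrier_past _ _ N) => //; rewrite /N; lia.
have := past (up (x k)) (up (x k.+1)) mB pastB.
have mBw : measurable [set w | B (process eta w)] by exact: (mw k x).
rewrite -/Q => E; transitivity
  (prb P [set w | B (process eta w) /\ (eta N w = up (x k) /\ eta (N + 1) w = up (x k.+1))]).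
  apply: prb_ae => //.
    apply: measurableI => //.
    by apply: measurableI; [exact: (meta N [set up (x k)])|exact: (meta (N + 1) [set up (x k.+1)])].
  apply: filterS2 (ae_edge N) (ae_edge (N + 1)) => w [_ e0] [v1 e1].
  split=> [ww|[Bw [eN eN1]] i].
    have E1 : edge (N + 1) w = x k.+1 by rewrite -NE; exact: ww.
    have E0 : edge N w = x k by apply: ww.
    split; first by move=> i ik; exact: (ww i (leqW ik)).
    by rewrite e0 e1 -/(edge N w) -/(edge (N + 1) w) E0 E1.
  rewrite leq_eqVlt => /predU1P[->|ik]; last exact: Bw.
  have E0 : edge N w = x k by exact: Bw.
  rewrite NE /edge addrK [RHS]surjective_pairing adj -E0 /=; congr (_, _).
  move: eN1 v1 vx; rewrite e1 addrK [x k.+1]surjective_pairing adj -E0 /valid /up /=.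
  move: (V (N + 1) w) (V N w) (x k.+1).2 => a b c.
  by case: eqP => [->|na] /esym; [move/eqP|move=> nc; rewrite nc => /eqP -> /eqP].
rewrite E; congr (_ * _); apply: prb_ae => //.
  by apply: measurableI => //; exact: (meta N [set up (x k)]).
apply: filterS (ae_edge N) => w [_ e0]; split=> [[]//|ww].
by split=> //; rewrite e0 -/(edge N w); congr up; exact: (ww k).
Qed.

(** A path from [a] to [b] and back is its own reversal. What remains is a monotone pair, covered by
    [edge_balance], or a flat step next to an edge between 0 and 1, covered by [flat_balance]. *)
Let edge_reversible e e' :
  pi e * Qedge e e' = pi (e'.2, e'.1) * Qedge (e'.2, e'.1) (e.2, e.1).
Proof.
rewrite pi_swap; case: e e' => [a b] [c e].
have valid_sym x y : valid (y, x) = valid (x, y) by rewrite /valid /=; lia.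
rewrite /Qedge /= (valid_sym a b) (eq_sym c b).
case: eqP => [<-|_]; last by rewrite !mulr0.
rewrite !andTb.
have [vab|nvab] := boolP (valid (a, b)); last by rewrite pi_invalid // mul0r mulr0.
have [vbe|nvbe] := boolP (valid (b, e)); last by rewrite (pi_invalid nvbe) // mul0r mulr0.
have F1 : (a.+1 == a.+3) = false by lia.
have F2 : (a == a.+2) = false by lia.
move: vab vbe; rewrite /valid /up /Q /two_state /= => /orP[] /eqP -> /orP[] /eqP ->.
- by rewrite !eqxx F1 F2; exact: edge_balance.
- by rewrite eqxx F2; have /= -> := pi_swap (a, a.+1).
- case: a F1 F2 => [|a] F1 F2 /=; first by rewrite -flat_balance.
  by rewrite eqxx ltn_eqF //; have /= -> := pi_swap (a, a.+1).
case: a F1 F2 => [|[|a]] F1 F2 //=; first by have /= -> := pi_swap (0%N, 1%N); rewrite flat_balance.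
have F3 : (a == a.+2) = false by lia.
rewrite !eqxx F3; have /= -> := pi_swap (a.+1, a.+2); have /= -> := pi_swap (a, a.+1).
have F4 : (a.+1 == a.+3) = false by lia.
by rewrite F4 edge_balance.
Qed.

Let revV : eq_in_law P (process V) (process (fun n => V (- n))).
Proof.
pose swap (e : nat * nat) := (e.2, e.1).
have swapK : involutive swap by case.
have dN := discrete_prod discrete_nat discrete_nat.
have rev := reversible_law 1 dN swapK medge edge_markov piE pi_swap edge_reversible.
pose second (z : zseq (nat * nat)%type) : zseq nat := fun n => (z n).2.
have msecond : measurable_fun setT second.
  apply: measurable_zseq => n; apply: dmeas_measurable_fun; apply: (dmeas_comp snd).
  exact: (discrete_dmeas dN (measurable_coord n)).
have := eq_in_law_comp msecond rev.
rewrite (_ : second \o process (fun n => swap \o edge (1 - n)) = process (fun n => V (- n))) //.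
apply/funext => w; apply/funext => n; rewrite /second /process /swap /edge /=.
by congr (V _ w); lia.
Qed.

(** With two states there is a single level to cross, so stationarity of the flow is already
    detailed balance. *)
Let reveta : eq_in_law P (process eta) (process (fun n => eta (1 - n))).
Proof.
pose rho b := prb P [set w | eta 0 w = b].
have rhoE n b : prb P [set w | eta n w = b] = rho b.
  exact: (stationary_one n (B := [set b]) statE).
have eta2 := markov_pair etaQ.
have balance b c : rho b * Q b c = rho c * Q c b.
  have flux1 : rho false * Q false true = rho true * Q true false.
    rewrite -(rhoE 0) -(rhoE 0 true) -!eta2.
    have mnat n : dmeas (fun w => nat_of_bool (eta n w)) := dmeas_comp nat_of_bool (meta n).
    have E b' c' : [set w | eta 0 w = b' /\ eta (0 + 1) w = c'] =
        [set w | nat_of_bool (eta 0 w) = b' /\ nat_of_bool (eta (0 + 1) w) = c'].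
      by apply/seteqP; split=> w /=; case: (eta 0 w) (eta (0 + 1) w) b' c' => -[] [] [] //= [].
    rewrite !E; apply: (flux (mnat 0) (mnat (0 + 1))).
      have := stationary_one (0 + 1) (B := [set b : bool | (b <= 0)%N]) statE.
      by move=> /(_ _) ->.
    by apply: aeW => w; case: (eta 0 w) (eta (0 + 1) w) => -[].
  by case: b c => -[].
exact: (reversible_law (s := id) 1 discrete_bool _ meta etaQ rhoE _ balance).
Qed.

Lemma two_state_T_invariant : subcritical_and_T_invariant P (fun w n => eta n w).
Proof.
split; first exact: (growth_subcritical p0_itv p1_itv p01 meta etaQ).
apply: (@T_invariance _ _ _ P eta V) => //.
  by apply: filterS rule => w [].
by apply: filterS rule => w [].
Qed.

End two_state_chain.

(** * Independent sites as a two-state chain *)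

Section iid_bernoulli.
Context (R : realType) (p : R) d (Omega : measurableType d) (P : probability Omega R).
Context (eta : int -> {RV P >-> bool}).
Hypothesis p01 : 0 <= p <= 1.
Hypothesis iid : iid_bernoulli p eta.

Let q (b : bool) : R := if b then p else 1 - p.

Let one_site n b : P (eta n @^-1` [set b]) = (q b)%:E.
Proof.
have -> : P (eta n @^-1` [set b]) = bernoulli_prob p [set b] by rewrite -(iid.2 n).
rewrite bernoulli_probE // !diracE; case: b.
  by rewrite (@mem_set _ [set true] true) // (@memNset _ [set true] false) // mule1 mule0 adde0.
by rewrite (@mem_set _ [set false] false) // (@memNset _ [set false] true) // mule1 mule0 add0e.
Qed.

Let window_prod n k x :
  P (window_event eta n k x) = (\prod_(0 <= i < k.+1) (q (x i))%:E)%E.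
Proof.
pose f (i : nat) : int := n + i%:Z.
pose s : seq int := map f (index_iota 0 k.+1).
pose A (m : int) : set bool := [set x (absz (m - n)%R)].
have us : uniq s by rewrite map_inj_uniq ?iota_uniq // => i j /addrI [].
have xE i : A (n + i%:Z) = [set x i] by rewrite /A addrC addKr.
have -> : window_event eta n k x = [set w | forall m : int, m \in s -> A m (eta m w)].
  apply/seteqP; split=> w ww.
    move=> m; rewrite /s => /mapP[j]; rewrite mem_index_iota ltnS => /= jk ->.
    by rewrite xE; exact: ww.
  move=> i ik; have : A (n + i%:Z) (eta (n + i%:Z) w).
    by apply: ww; rewrite (map_f f) // mem_index_iota.
  by rewrite xE.
rewrite iid.1 // big_map; apply: eq_bigr => i _.
by rewrite xE one_site.
Qed.

(** Equal rows forget the current state, so (a) falls under the argument for (b), whose results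
    accordingly admit [p0 = 0]. *)
Lemma iid_bernoulli_markov : stationary_markov_chain (two_state p p) eta.
Proof.
have dB := discrete_bool.
have meta n : dmeas (eta n) := dmeas_RV _ dB.
split=> [n k x|k].
  rewrite !window_prod big_nat_recr //=; congr (_ * _)%E.
  by rewrite /two_state; case: (x k).
apply: (eq_in_law_windows (X := fun n => eta (n + k)) dB) => // M x.
rewrite /prb (_ : window_event (fun n => eta (n + k)) _ _ _ = window_event eta (k - M%:Z) M.*2 x).
  by rewrite !window_prod.
by apply/seteqP; split=> w ww i iM; rewrite -(ww i iM) /=; congr (eta _ w); lia.
Qed.

End iid_bernoulli.

Theorem theorem1p8 (R : realType) (d : measure_display)
    (Omega : measurableType d) (P : probability Omega R) :
  [/\ (forall p : R, 0 <= p < 1 / 2 ->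
        forall eta : int -> {RV P >-> bool}, iid_bernoulli p eta ->
          subcritical_and_T_invariant P (fun w n => eta n w)),
      (forall p0 p1 : R, 0 < p0 < 1 -> 0 <= p1 < 1 -> p0 + p1 < 1 ->
        forall eta : int -> {RV P >-> bool},
          stationary_markov_chain (two_state p0 p1) eta ->
          subcritical_and_T_invariant P (fun w n => eta n w)) &
      (forall (p : R) (K : nat), 0 < p < 1 ->
        forall (lambda : R) (h : 'cV[R]_K.+1), 0 < lambda < 1 ->
          perron_pair (carrier_matrix_trunc p K) lambda h ->
        forall W : int -> {RV P >-> 'I_K.+1},
          stationary_markov_chain
            (doob_transform (carrier_matrix_trunc p K) lambda h) W ->
          subcritical_and_T_invariant P (up_steps W))].
Proof.
have half (p : R) : p < 1 / 2 -> p + p < 1 by lra.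
split.
- move=> p /andP[p_ge0 p_half] eta iid.
  have p_lt1 : p < 1 by lra.
  have p01 : 0 <= p < 1 by rewrite p_ge0.
  have [markE statE] : stationary_markov_chain (two_state p p) eta.
    by apply: iid_bernoulli_markov iid; rewrite p_ge0 ltW.
  exact: (two_state_T_invariant p01 p01 (half p p_half) markE statE).
- move=> p0 p1 /andP[p0_gt0 p0_lt1] p1_itv p01 eta [markE statE].
  have p0_itv : 0 <= p0 < 1 by rewrite ltW.
  exact: (two_state_T_invariant p0_itv p1_itv p01 markE statE).
- move=> p K /andP[p_gt0 p_lt1] lambda h /andP[l_gt0 _] [_ Ah h_gt0] W [markW statW].
  exact: (conditioned_T_invariant p_gt0 p_lt1 l_gt0 Ah h_gt0 markW statW).
Qed.
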